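(* For all integers $n\ge 2$ and $k\ge 0$, $DCell_k$ (with parameter $n$) is $(n+k-4)$-fault Hamiltonian-connected and $(n+k-3)$-fault Hamiltonian.
   Context: DCell: fix an integer $n\ge 2$. $DCell_0=D_0$ is the complete graph $K_n$, and $t_0=n$. For $k\ge 1$, $D_k=DCell_k$ is built from $t_{k-1}+1$ vertex-disjoint copies $D_{k-1}^0,\dots,D_{k-1}^{t_{k-1}}$ of $D_{k-1}$ together with level $k$ edges; $t_k=t_{k-1}(t_{k-1}+1)$. A vertex of $D_{k-1}$ with label $(\alpha_{k-1},\dots,\alpha_0)$, $\alpha_0\in\{0,\dots,n-1\}$, $\alpha_j\in\{0,\dots,t_{j-1}\}$, has $uid_{k-1}=\alpha_0+\sum_{l=1}^{k-1}\alpha_l t_{l-1}\in\{0,\dots,t_{k-1}-1\}$; a vertex of $D_k$ in copy $D_{k-1}^i$ gets label $(i,\alpha_{k-1},\dots,\alpha_0)$. For each pair $a<b$, the vertex with $uid_{k-1}=b-1$ in $D_{k-1}^a$ is joined to the vertex with $uid_{k-1}=a$ in $D_{k-1}^b$. A graph $G$ is $f$-fault Hamiltonian (resp. $f$-fault Hamiltonian-connected) if for every set $F$ of faulty elements (vertices and/or edges of $G$) with $|F|\le f$, the graph $G\setminus F$ has a Hamiltonian cycle (resp. every pair of distinct vertices of $G\setminus F$ is joined by a Hamiltonian path of $G\setminus F$). *)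

(* Defs.v *)
From HB Require Import structures.
From mathcomp Require Import all_boot all_order all_algebra.
Set Implicit Arguments. Unset Strict Implicit. Unset Printing Implicit Defensive.
Import Order.TTheory GRing.Theory Num.Theory.

Fixpoint dcell_t (n k : nat) : nat :=
  match k with
  | 0 => n
  | k'.+1 => dcell_t n k' * (dcell_t n k').+1
  end.

(* Adjacency of DCell_k, vertices identified with their uid_k in {0..t_k-1}.
   A vertex of D_k lying in copy D_{k-1}^a with uid_{k-1} = u has
   uid_k = a * t_{k-1} + u (this is exactly alpha_0 + sum_l alpha_l t_{l-1}).
   Level 0: complete graph K_n.
   Level k: edges inside each copy, plus for a < b the edge between
   (copy a, uid b-1) and (copy b, uid a). *)
Fixpoint dcell_adj (n k : nat) (x y : nat) : bool :=
  match k with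
  | 0 => x != y
  | k'.+1 =>
      let T := dcell_t n k' in
      let a := x %/ T in let u := x %% T in
      let b := y %/ T in let w := y %% T in
      if a == b then dcell_adj n k' u w
      else [&& a < b, u == b.-1 & w == a] || [&& b < a, w == a.-1 & u == b]
  end.

Definition DCell (n k : nat) : rel 'I_(dcell_t n k) :=
  fun x y => dcell_adj n k x y.
Arguments DCell : clear implicits.

Section Faults.
Variable V : finType.
Variable adj : rel V.

Definition is_edge (e : {set V}) : bool :=
  [exists x, exists y, adj x y && (e == [set x; y])].

Definition live_edge (FE : {set {set V}}) (x y : V) : bool :=
  adj x y && ([set x; y] \notin FE).

Definition ham_cycle (FV : {set V}) (FE : {set {set V}}) (s : seq V) : Prop :=
  [/\ uniq s, (forall w, (w \in s) = (w \notin FV)), 3 <= size s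
    & cycle (live_edge FE) s].

Definition ham_path (FV : {set V}) (FE : {set {set V}}) (u v : V) (s : seq V) : Prop :=
  [/\ uniq (u :: s), (forall w, (w \in u :: s) = (w \notin FV)),
      last u s = v & path (live_edge FE) u s].

Definition fault_hamiltonian (f : int) : Prop :=
  forall (FV : {set V}) (FE : {set {set V}}),
    (forall e, e \in FE -> is_edge e) ->
    ((#|FV| + #|FE|)%:Z <= f)%R ->
    exists s, ham_cycle FV FE s.

Definition fault_hamiltonian_connected (f : int) : Prop :=
  forall (FV : {set V}) (FE : {set {set V}}),
    (forall e, e \in FE -> is_edge e) ->
    ((#|FV| + #|FE|)%:Z <= f)%R ->
    forall u v, u \notin FV -> v \notin FV -> u != v ->
    exists s, ham_path FV FE u v s.
End Faults.

(* Main.v *)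
Require Import Defs.
From mathcomp Require Import all_boot all_order all_algebra zify.
Set Implicit Arguments. Unset Strict Implicit. Unset Printing Implicit Defensive.

(** The proof is an induction on [k]. Let [DCell_k] have t vertices, and suppose that it tolerates g
    faults for Hamiltonian connectedness and g+1 faults for Hamiltonicity; then [DCell_(k+1)]
    tolerates g+1 and g+2 faults ([tolerant_connected_step], [tolerant_cyclic_step], [dcell_step]).
    Any two of its t+1 copies are joined by exactly one outer edge, and every vertex has exactly one
    outer edge. So a vertex is an ordered pair (a, b) of distinct copies, and contracting the copies
    gives the complete graph on t+1 vertices, of which each fault destroys at most one edge.

    If no copy holds more than g faults, all copies remain Hamiltonian-connected. A Hamiltonian path
    or cycle of the contracted graph then lifts: each copy is crossed from the vertex facing its
    predecessor to the vertex facing its successor ([route_core]). The contracted graph is complete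
    up to few missing edges. On m vertices, m-4 missing edges leave it Hamiltonian-connected, m-3
    leave a cycle (m being at least 3) and m-2 leave a path ([free_hpath], [free_hcycle],
    [free_hpath_any]). In the borderline cases nearly all faults are spent on missing edges, which
    leaves the rest undamaged and allows special routes ([route_spread_same],
    [route_spread_distinct]).

    If a copy holds g+1 faults, it still has a Hamiltonian cycle, which is opened at a well-chosen
    edge. For connectedness all faults are then in that copy and everything else is intact
    ([route_distinct] is the hardest case). When a copy has one fault too many for the property
    wanted, one fault is restored and the resulting path or cycle is cut there
    ([tolerant_connected_cut], [tolerant_cyclic_cut]).

    The step needs t to be at least 2g+8, or complete copies with t = g+4 and g positive. The first
    holds for k at least 1 ([dcell_t_ge]), the second for k = 0 and n at least 5. What remains,
    [DCell_1] for n = 2, 3, 4 and [DCell_2] for n = 2, is settled by an exhaustive search whose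
    answers are checked. *)

(** * Hamiltonian paths and cycles of a vertex subset *)

Section Hamilton.
Variable V : finType.
Implicit Types (r : rel V) (S A B : {set V}).

Definition hpath r S u v :=
  exists s, [/\ uniq (u :: s), u :: s =i S, last u s = v & path r u s].

Definition hcycle r S := exists s, [/\ uniq s, s =i S, 2 < size s & cycle r s].

(** A Hamiltonian path with one step missing: the gap from [x] to [y] is to be filled by a detour
    through vertices outside [S]. *)
Definition hsplit r S u v x y :=
  exists S1 S2, [/\ S = S1 :|: S2, [disjoint S1 & S2], hpath r S1 u x
                  & hpath r S2 y v].

Lemma size_enumeration S s : uniq s -> s =i S -> size s = #|S|.
Proof. by move=> us sS; rewrite -(card_uniqP us); apply: eq_card. Qed.

Lemma hpath_ends r S u v : hpath r S u v -> (u \in S) /\ (v \in S).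
Proof. by case=> s [_ eS <- _]; rewrite -!eS mem_head mem_last. Qed.

Lemma hpath_neq r S u v : 1 < #|S| -> hpath r S u v -> u != v.
Proof.
move=> S1 [s [us eS <- _]]; rewrite -(size_enumeration us eS) in S1.
case: s us eS S1 => //= y s /andP[ui _] _ _.
by apply: contraNneq ui => ->; apply: mem_last.
Qed.

Lemma path_mono r r' S u s : uniq (u :: s) -> {subset u :: s <= S} ->
  (forall x y, x \in S -> y \in S -> x != y -> r x y -> r' x y) ->
  path r u s -> path r' u s.
Proof.
move=> us sS rr'; elim: s u us sS => //= y s IH u.
rewrite inE negb_or -andbA => /and3P[uy us /andP[ys Us]] sS /andP[ruy p].
rewrite rr' ?sS ?mem_head ?inE ?eqxx ?orbT //=; apply: IH => //=; first by rewrite ys.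
by move=> z zs; apply: sS; rewrite inE zs orbT.
Qed.

Lemma hpath_mono r r' S u v :
  (forall x y, x \in S -> y \in S -> x != y -> r x y -> r' x y) ->
  hpath r S u v -> hpath r' S u v.
Proof.
move=> rr' [s [us eS lS p]]; exists s; split=> //.
by apply: path_mono us _ rr' p => x; rewrite eS.
Qed.

Lemma hpath_sym r S u v : symmetric r -> hpath r S u v -> hpath r S v u.
Proof.
move=> rs [s [us eS lS p]]; exists (rev (belast u s)).
have E : v :: rev (belast u s) = rev (u :: s) by rewrite (lastI u s) rev_rcons lS.
split; rewrite ?E ?rev_uniq //.
- by move=> x; rewrite mem_rev eS.
- by rewrite -[LHS](last_cons v) E rev_cons last_rcons.
- by rewrite -lS rev_path; apply: sub_path p => x y; rewrite rs.
Qed.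

Lemma hpath1 r u : hpath r [set u] u u.
Proof. by exists [::]; split=> // x; rewrite !inE. Qed.

Lemma hpath_cat r S1 S2 u x y v : hpath r S1 u x -> hpath r S2 y v -> r x y ->
  [disjoint S1 & S2] -> hpath r (S1 :|: S2) u v.
Proof.
move=> [s1 [u1 e1 l1 p1]] [s2 [u2 e2 l2 p2]] rxy dis.
exists (s1 ++ y :: s2); split.
- rewrite -cat_cons cat_uniq; apply/and3P; split=> //; apply/hasPn => z; rewrite /= e1 e2.
  by move=> zS; apply: contraL zS => zS1; rewrite (disjointFr dis).
- by move=> z; rewrite -cat_cons mem_cat e1 e2 inE.
- by rewrite last_cat.
- by rewrite cat_path p1 /= l1 rxy p2.
Qed.

Lemma hpath_cons r S u y v : hpath r S y v -> r u y -> u \notin S ->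
  hpath r (u |: S) u v.
Proof.
by move=> p ruy uS; apply: hpath_cat (hpath1 r u) p ruy _; rewrite disjoints1.
Qed.

Lemma hcycle_close r S u v : hpath r S u v -> r v u -> 2 < #|S| -> hcycle r S.
Proof.
move=> [s [us eS lS p]] rvu S3; exists (u :: s); split=> //.
  by rewrite (size_enumeration us eS).
by rewrite /= rcons_path p lS.
Qed.

Lemma hcycle_rot r S x : hcycle r S -> x \in S ->
  exists y s, [/\ uniq (x :: y :: s), x :: y :: s =i S, 0 < size s
                & path r x (rcons (y :: s) x)].
Proof.
move=> [s [us eS s3 c]]; rewrite -eS => xs.
have [i s' E] := rot_to xs.
have sz : size s = (size s').+1 by rewrite -(size_rot i) E.
case: s' E sz => [|y s'] E sz; first by rewrite sz in s3.
exists y, s'; split.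
- by rewrite -E rot_uniq.
- by move=> z; rewrite -E mem_rot eS.
- by move: s3; rewrite sz.
- by move: c; rewrite -(rot_cycle i) E.
Qed.

(** A vertex of [B] spoils the step leaving it and a vertex of [A] the step entering it. Some step
    of the cycle is unspoiled, and dropping it opens the cycle. *)
Lemma hcycle_cut r S A B : hcycle r S -> #|A :&: S| + #|B :&: S| < #|S| ->
  exists x y, [/\ x \notin A, y \notin B, x != y & hpath r S x y].
Proof.
move=> hc lt; have [s [us eS s3 c]] := hc.
have [x xS /andP[xB nA]] : exists2 x, x \in S & (x \notin B) && (next s x \notin A).
  apply/exists_inP; apply: contraLR lt; rewrite negb_exists_in -leqNgt => /forall_inP H.
  have sub : S \subset (B :&: S) :|: [set x in S | next s x \in A].
    apply/subsetP => x xS; move: (H x xS); rewrite negb_and !negbK !inE xS !andbT.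
    by [].
  apply: leq_trans (subset_leq_card sub) _; apply: leq_trans (leq_card_setU _ _) _.
  rewrite addnC leq_add2r -(card_in_imset (f := next s)).
    apply/subset_leq_card/subsetP => z /imsetP[x]; rewrite !inE => /andP[xS xA] ->.
    by rewrite xA -eS mem_next eS.
  by move=> x y _ _ e; rewrite -(prev_next us x) e prev_next.
have [i s' E] : rot_to_spec s x by apply: rot_to; rewrite eS.
have us' : uniq (x :: s') by rewrite -E rot_uniq.
case: s' E us' => [|y s'] E us'.
  by have := s3; rewrite -(size_rot i) E.
have ny : next s x = y by rewrite -(next_rot i) // E /= eqxx.
exists y, x; split=> //; first by rewrite -ny.
  by move: us'; rewrite /= inE negb_or eq_sym => /andP[/andP[]].
exists (rcons s' x); split.
- by rewrite -rcons_cons rcons_uniq.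
- by move=> z; rewrite -rcons_cons mem_rcons -E mem_rot eS.
- by rewrite last_rcons.
- by move: c; rewrite -(rot_cycle i) E /= => /andP[].
Qed.

Lemma hcycle_nbrs r S x : symmetric r -> hcycle r S -> x \in S ->
  exists y z, [/\ y != z, hpath r S x y & hpath r S x z].
Proof.
move=> rs hc xS; have [y [s [us eS s0 p]]] := hcycle_rot hc xS.
exists (last y s), y; split.
- move: us s0; case: s {eS p} => //= z s /and3P[_ + _] _.
  by move=> yi; apply: contraNneq yi => <-; apply: mem_last.
- by exists (y :: s); split=> //; move: p; rewrite rcons_path => /andP[].
apply: hpath_sym => //; exists (rcons s x); split.
- by rewrite -rcons_cons rcons_uniq.
- by move=> z; rewrite -rcons_cons mem_rcons eS.
- by rewrite last_rcons.
- by move: p => /= /andP[].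
Qed.

(** A vertex of [A] spoils at most two consecutive pairs, and the head only one; the subtracted
    boolean records this and keeps the induction going. *)
Lemma seq_split A u s : uniq (u :: s) ->
  (count (mem A) (u :: s)).*2 - (u \in A) < size s ->
  exists s1 y s2, [/\ s = s1 ++ y :: s2, last u s1 \notin A & y \notin A].
Proof.
elim: s u => [|y s IH] u // us lt.
have [/andP[uA yA]|bad] := boolP ((u \notin A) && (y \notin A)).
  by exists [::], y, s.
have /IH[|s1 [z [s2 [-> l1 zA]]]] : uniq (y :: s) by case/andP: us.
  by move: lt bad; rewrite /=; case: (u \in A); case: (y \in A) => //=; lia.
by exists (y :: s1), z, s2.
Qed.

Lemma hsplit_cat r S u s1 y s2 v : uniq (u :: s1 ++ y :: s2) ->
  u :: s1 ++ y :: s2 =i S -> last y s2 = v -> path r u s1 -> path r y s2 ->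
  hsplit r S u v (last u s1) y.
Proof.
rewrite -cat_cons cat_uniq => /and3P[u1 /hasPn dis u2] eS lS p1 p2.
exists [set z in u :: s1], [set z in y :: s2]; split.
- by apply/setP => z; rewrite -eS mem_cat in_setU !in_set.
- rewrite -setI_eq0; apply/eqP/setP => z; rewrite in_setI !in_set.
  by apply/negbTE; rewrite negb_and orbC -implybE; apply/implyP => /dis.
- by exists s1; split=> // z; rewrite in_set.
- by exists s2; split=> // z; rewrite in_set.
Qed.

Lemma hpath_split r S A u v : hpath r S u v -> #|A :&: S|.*2 < #|S|.-1 ->
  exists x y, [/\ x \notin A, y \notin A & hsplit r S u v x y].
Proof.
move=> [s [us eS lS p]] lt.
have cA : count (mem A) (u :: s) = #|A :&: S|.
  rewrite -size_filter; apply: size_enumeration; first exact: filter_uniq.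
  by move=> z; rewrite mem_filter eS [RHS]inE.
have [|s1 [y [s2 [e xA yA]]]] := seq_split (A := A) us.
  rewrite cA; apply: leq_ltn_trans (leq_subr _ _) _.
  by move: lt; rewrite -(size_enumeration us eS).
rewrite e cat_path last_cat /= in us eS lS p; case/and3P: p => p1 _ p2.
by exists (last u s1), y; split=> //; apply: hsplit_cat lS p1 p2.
Qed.

Lemma hpath_neqrel S u v : u \in S -> v \in S -> u != v ->
  hpath (fun x y => x != y) S u v.
Proof.
move=> uS vS uv; pose T := enum (S :\ u :\ v).
have mT z : (z \in T) = [&& z != v, z != u & z \in S] by rewrite mem_enum !inE.
have U : uniq (u :: rcons T v).
  by rewrite /= rcons_uniq mem_rcons inE !mT !eqxx (negbTE uv) /= enum_uniq.
exists (rcons T v); split=> //.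
- move=> z; rewrite inE mem_rcons inE mT.
  case: (z =P u) => [->|]; first by rewrite uS.
  by case: (z =P v) => [->|]; rewrite ?vS.
- by rewrite last_rcons.
- elim: (rcons T v) (u) U => //= y s IH z /and3P[]; rewrite inE negb_or.
  by case/andP => -> _ ys us; rewrite /= IH //= ys us.
Qed.

End Hamilton.

(** * Complete graphs with few missing edges *)

Section NearlyComplete.
Variables (V : finType) (M : {set {set V}}).
Implicit Types (S A B : {set V}).

Definition free_pair x y := (x != y) && ([set x; y] \notin M).
Definition pairs_in B := [set e in M | (#|e| == 2) && (e \subset B)].
Definition pairs_at B x := [set e in pairs_in B | x \in e].
Definition blocked B x := [set y in B | (y != x) && ([set x; y] \in M)].

Lemma free_pair_sym : symmetric free_pair.
Proof. by move=> x y; rewrite /free_pair eq_sym setUC. Qed.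

Lemma cardsD1_in B x : x \in B -> #|B| = #|B :\ x|.+1.
Proof. by move=> xB; rewrite (cardsD1 x B) xB. Qed.

Lemma card_pairs_in B x :
  #|pairs_in B| = #|pairs_at B x| + #|pairs_in (B :\ x)|.
Proof.
rewrite -(cardsID [set e : {set V} | x \in e] (pairs_in B)).
congr (_ + _); apply: eq_card => e; rewrite !inE // subsetD1.
by rewrite andbC -!andbA.
Qed.

Lemma set2_inj (x y z : V) : y != x -> [set x; y] = [set x; z] -> y = z.
Proof.
move=> yx e; have := set22 x y; rewrite e !inE (negbTE yx).
by move/eqP.
Qed.

Lemma card_blocked B x : x \in B -> #|blocked B x| <= #|pairs_at B x|.
Proof.
move=> xB; rewrite -(card_in_imset (f := fun y => [set x; y])).
  apply/subset_leq_card/subsetP => _ /imsetP[y + ->].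
  rewrite !inE => /and3P[yB yx ->]; rewrite eqxx /= andbT cards2 (eq_sym x) yx /=.
  by apply/subsetP => z; rewrite !inE => /orP[]/eqP->.
by move=> y z; rewrite !inE => /and3P[_ yx _] _; apply: set2_inj.
Qed.

Lemma free_pairP B x y : y \in B -> x != y -> y \notin blocked B x -> free_pair x y.
Proof. by rewrite /free_pair in_set => -> xy; rewrite xy eq_sym xy. Qed.

Lemma free_nbr B (X : {set V}) x : x \in B -> #|pairs_at B x| + #|X| + 1 < #|B| ->
  exists y, [/\ y \in B, y \notin X, x != y & free_pair x y].
Proof.
move=> xB lt.
have /subsetPn[y yB] : ~~ (B \subset x |: (blocked B x :|: X)).
  apply: contraTN lt => /subset_leq_card; rewrite -leqNgt => le.
  apply: leq_trans le _; rewrite cardsU1; apply: leq_trans (leq_add (leq_b1 _) (leqnn _)) _.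
  have := (leq_card_setU (blocked B x) X).1; have := card_blocked xB; lia.
rewrite in_setU1 in_setU !negb_or eq_sym => /and3P[xy yb yX].
by exists y; split=> //; apply: free_pairP yb.
Qed.

Lemma pairs_at0 B x y : x \in B -> pairs_at B x = set0 -> y \in B -> x != y ->
  free_pair x y.
Proof.
move=> xB e yB xy; apply: (free_pairP yB) => //.
by have := card_blocked xB; rewrite e cards0 leqn0 cards_eq0 => /eqP->; rewrite inE.
Qed.

Let r := free_pair.

Lemma hpath_cons_in B x y v : x \in B -> hpath r (B :\ x) y v -> r x y ->
  hpath r B x v.
Proof.
by move=> xB p rxy; rewrite -(setD1K xB); apply: hpath_cons p rxy _; rewrite !inE eqxx.
Qed.

(** The two claims feed each other when one vertex [x] is removed. If [x] lies on no missing pair,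
    it attaches to either end of any path of the rest. If it lies on enough missing pairs, the rest
    has so few that a path may be started at a chosen free neighbour of [x]. *)
Lemma free_hpath_any_from m B : #|B| = m ->
  (0 < m -> #|pairs_in B| <= m - 2 -> exists x y, hpath r B x y) /\
  (forall x, x \in B -> #|pairs_in B| + 3 <= m -> exists y, hpath r B x y).
Proof.
elim: m B => [|m IH] B Bm; first by split=> // x; rewrite (cards0_eq Bm) inE.
have Bx x : x \in B -> #|B :\ x| = m by move/cardsD1_in; rewrite Bm => -[].
have P1 x : x \in B -> #|pairs_in B| + 3 <= m.+1 -> exists y, hpath r B x y.
  move=> xB le; have [IH0 IH1] := IH _ (Bx x xB); have ce := card_pairs_in B x.
  have [e|] := eqVneq (pairs_at B x) set0.
    have [||c [d p]] := IH0; [lia|lia|].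
    exists d; apply: (hpath_cons_in xB p).
    have [] := hpath_ends p; rewrite !inE => /andP[cx cB] _.
    by apply: (pairs_at0 xB e) => //; rewrite eq_sym.
  rewrite -card_gt0 => Jx.
  have [|c [cB _ xc rxc]] := free_nbr (X := set0) xB; first by rewrite cards0; lia.
  have [||d p] := IH1 c; [by rewrite !inE eq_sym xc|lia|].
  by exists d; exact: hpath_cons_in p rxc.
split=> // _ le.
have [m0|m0] := posnP m.
  have /cards1P[x ->] : #|B| == 1 by rewrite Bm m0.
  by exists x, x; apply: hpath1.
have [/exists_inP[x xB Jx]|] := boolP [exists x in B, 1 < #|pairs_at B x|].
  have [IH0 IH1] := IH _ (Bx x xB); have ce := card_pairs_in B x.
  have [|c [cB _ xc rxc]] := free_nbr (X := set0) xB; first by rewrite cards0; lia.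
  have [||d p] := IH1 c; [by rewrite !inE eq_sym xc|lia|].
  by exists x, d; exact: hpath_cons_in p rxc.
rewrite negb_exists_in => /forall_inP J1.
(* Every vertex is now on at most one missing pair. Removing one that is on such a pair keeps the
   bound for the rest. *)
have [x xB Jx] : exists2 x, x \in B & 0 < #|pairs_at B x| \/ pairs_in B = set0.
  have /card_gt0P[x xB] : 0 < #|B| by rewrite Bm.
  have [/exists_inP[y yB Jy]|] := boolP [exists y in B, 0 < #|pairs_at B y|].
    by exists y => //; left.
  rewrite negb_exists_in => /forall_inP J0; exists x => //; right.
  apply/setP => e; rewrite in_set0; apply/negbTE/negP => eM.
  have [e2 /subsetP eB] : #|e| = 2 /\ e \subset B.
    by move: eM; rewrite inE => /and3P[_ /eqP].
  have [y ye] : exists y, y \in e by apply/card_gt0P; rewrite e2.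
  have := J0 y (eB y ye); rewrite -eqn0Ngt cards_eq0 => /eqP/setP/(_ e).
  by rewrite in_set eM ye in_set0.
have [IH0 _] := IH _ (Bx x xB); have ce := card_pairs_in B x.
have [||c [d p]] := IH0; first by lia.
  by case: Jx => [|e]; rewrite ?e ?cards0 in ce *; lia.
have [[cx cB] [dx dB]] : (c != x /\ c \in B) /\ (d != x /\ d \in B).
  by have := hpath_ends p; rewrite !in_setD1 => -[/andP[-> ->] /andP[-> ->]].
(* At most one of the two ends is blocked for [x], so [x] attaches to the other. *)
have [e|nc] := boolP (free_pair x c).
  by exists x, d; exact: hpath_cons_in p e.
exists x, c; apply: (hpath_cons_in xB (hpath_sym free_pair_sym p)).
have [m1|m2] := leqP m 1.
  case: Jx => [|e]; first by lia.
  apply: (pairs_at0 xB _ dB); last by rewrite eq_sym.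
  by apply/eqP; rewrite -cards_eq0 -leqn0 -(cards0 {set V}) -e; lia.
apply: (free_pairP dB); rewrite 1?eq_sym //.
have cd : c != d by apply: hpath_neq p; rewrite Bx.
have cb : c \in blocked B x by apply: contraNT nc; apply: free_pairP; rewrite 1?eq_sym.
apply/negP => db; have := card_blocked xB; have := J1 x xB.
have : [set c; d] \subset blocked B x by rewrite subUset !sub1set cb db.
by move/subset_leq_card; rewrite cards2 cd /=; lia.
Qed.

(** If [x] is on no missing pair, it attaches to the far end of a path of the rest started at [y].
    Otherwise a step to a free neighbour other than [y] uses up one vertex and at least one missing
    pair. *)
Lemma free_hpath B x y : x \in B -> y \in B -> x != y ->
  #|pairs_in B| + 4 <= #|B| -> hpath r B x y.
Proof.
have [m Bm] : exists m, #|B| <= m by exists #|B|.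
elim: m B Bm x => [|m IH] B Bm x xB yB xy le; first by lia.
have cB := cardsD1_in xB; have ce := card_pairs_in B x.
have yBx : y \in B :\ x by rewrite !inE eq_sym xy.
have [e|] := eqVneq (pairs_at B x) set0.
  have [_ P1] := free_hpath_any_from (erefl #|B :\ x|).
  have [|c p] := P1 y yBx; first by lia.
  apply: (hpath_cons_in xB (hpath_sym free_pair_sym p)).
  have [_] := hpath_ends p; rewrite !inE => /andP[cx cB'].
  by apply: (pairs_at0 xB e) => //; rewrite eq_sym.
rewrite -card_gt0 => Jx.
have [|c [cB' cX xc rxc]] := free_nbr (X := [set y]) xB; first by rewrite cards1; lia.
apply: (hpath_cons_in xB _ rxc); apply: IH => //; try lia.
- by rewrite !inE eq_sym xc.
- by rewrite inE in cX.
Qed.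

Lemma free_hpath_any B : 0 < #|B| -> #|pairs_in B| + 2 <= #|B| ->
  exists x y, hpath r B x y.
Proof. by move=> B0 le; have [P0 _] := free_hpath_any_from (erefl #|B|); apply: P0; lia. Qed.

Lemma hcycle_insert B x c d : x \in B -> 2 < #|B| -> hpath r (B :\ x) c d ->
  r x c -> r d x -> hcycle r B.
Proof.
by move=> xB B3 p xc dx; apply: (hcycle_close (u := x) (v := d)) => //; apply: hpath_cons_in p xc.
Qed.

(** A vertex on two missing pairs is removed, and two of its free neighbours are joined by
    [free_hpath]. A vertex on exactly one is inserted into a cycle of the rest at an edge avoiding
    its blocked partner; one on none closes up any path of the rest. *)
Lemma free_hcycle B : 2 < #|B| -> #|pairs_in B| + 3 <= #|B| -> hcycle r B.
Proof.
have [m Bm] : exists m, #|B| <= m by exists #|B|.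
elim: m B Bm => [|m IH] B Bm B3 le; first by lia.
have rC x y : r x y = r y x by apply: free_pair_sym.
have [/exists_inP[x xB Jx]|] := boolP [exists x in B, 1 < #|pairs_at B x|].
  have ce := card_pairs_in B x; have cB := cardsD1_in xB.
  have [|c [cB' _ xc rxc]] := free_nbr (X := set0) xB; first by rewrite cards0; lia.
  have [|d [dB' dX xd rxd]] := free_nbr (X := [set c]) xB; first by rewrite cards1; lia.
  apply: (hcycle_insert (d := d) xB B3 _ rxc); last by rewrite rC.
  apply: free_hpath; try lia; first by rewrite !inE eq_sym xc.
    by rewrite !inE eq_sym xd.
  by rewrite inE in dX; rewrite eq_sym.
rewrite negb_exists_in => /forall_inP J1.
have /card_gt0P[x xB] : 0 < #|B| by lia.
have ce := card_pairs_in B x; have cB := cardsD1_in xB.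
have [e|] := eqVneq (pairs_at B x) set0.
  have [||c [d p]] := free_hpath_any (B := B :\ x); [lia|by rewrite e cards0 in ce; lia|].
  have [[cx cB'] [dx dB]] : (c != x /\ c \in B) /\ (d != x /\ d \in B).
    by have := hpath_ends p; rewrite !in_setD1 => -[/andP[-> ->] /andP[-> ->]].
  apply: (hcycle_insert xB B3 p); last rewrite rC;
    by apply: (pairs_at0 xB e); rewrite // eq_sym.
rewrite -card_gt0 => Jx; have J1x := J1 x xB; have cb := card_blocked xB.
have hc : hcycle r (B :\ x) by apply: IH; lia.
have le1 : #|blocked B x :&: (B :\ x)| <= 1.
  by apply: leq_trans (subset_leq_card (subsetIl _ _)) _; lia.
have [|c [d [cA dA _ p]]] := hcycle_cut (A := blocked B x) (B := blocked B x) hc.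
  by lia.
have [[cx cB'] [dx dB]] : (c != x /\ c \in B) /\ (d != x /\ d \in B).
  by have := hpath_ends p; rewrite !in_setD1 => -[/andP[-> ->] /andP[-> ->]].
by apply: (hcycle_insert xB B3 p); last rewrite rC;
  apply: (free_pairP (B := B)); rewrite // eq_sym.
Qed.
End NearlyComplete.

(** * Fault tolerance of an induced subgraph *)

Section Tolerance.
Variable V : finType.
Implicit Types (S FV D : {set V}) (FE : {set {set V}}) (adj : rel V).

(** Faults are counted relative to [S], so that the same [FV] and [FE] serve the whole graph and
    each of its copies. *)
Definition nfaults S FV FE := #|FV :&: S| + #|pairs_in FE S|.

Definition tolerant_connected S adj f := forall FV FE, nfaults S FV FE <= f ->
  forall u v, u \in S :\: FV -> v \in S :\: FV -> u != v ->
  hpath (live_edge adj FE) (S :\: FV) u v.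

Definition tolerant_cyclic S adj f := forall FV FE, nfaults S FV FE <= f ->
  hcycle (live_edge adj FE) (S :\: FV).

(** [D] will hold vertices through which the path must not be left or re-entered. The bound f+1 is
    the number of faults allowed one level up; the 2 is for [route_same], where a fault-free copy
    avoids two vertices even if [f] is 0. *)
Definition tolerant_split S adj f := forall FV FE D u v,
  nfaults S FV FE <= f -> nfaults S FV FE + #|D| <= maxn f.+1 2 ->
  u \in S :\: FV -> v \in S :\: FV -> u != v ->
  exists x y, [/\ x \notin D, y \notin D &
    hsplit (live_edge adj FE) (S :\: FV) u v x y].

Lemma live_edge_sym adj FE : symmetric adj -> symmetric (live_edge adj FE).
Proof. by move=> s x y; rewrite /live_edge s setUC. Qed.

Lemma hsplit_neq (r : rel V) S u v x y : hsplit r S u v x y -> x != y.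
Proof.
move=> [S1 [S2 [_ dis p1 p2]]]; have [_ x1] := hpath_ends p1.
by have [y2 _] := hpath_ends p2; apply: contraTneq x1 => ->; rewrite (disjointFl dis).
Qed.

Lemma hsplit_ends (r : rel V) S u v x y : hsplit r S u v x y -> x \in S /\ y \in S.
Proof.
move=> [S1 [S2 [-> dis p1 p2]]]; have [_ x1] := hpath_ends p1.
by have [y2 _] := hpath_ends p2; rewrite !inE x1 y2 orbT.
Qed.

Lemma hsplit_mono (r r' : rel V) S u v x y :
  (forall a b, a \in S -> b \in S -> a != b -> r a b -> r' a b) ->
  hsplit r S u v x y -> hsplit r' S u v x y.
Proof.
move=> rr' [S1 [S2 [e dis p1 p2]]]; exists S1, S2; split=> //.
  by apply: hpath_mono p1 => a b aS bS; apply: rr'; rewrite e inE ?aS ?bS.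
by apply: hpath_mono p2 => a b aS bS; apply: rr'; rewrite e inE ?aS ?bS orbT.
Qed.

Lemma hsplit_remove (r : rel V) S z u v : hpath r (z |: S) u v -> z \notin S ->
  u != z -> v != z ->
  exists x y, [/\ r x z, r z y & hsplit r S u v x y].
Proof.
move=> [s [us eS lS p]] zS uz vz.
have zs : z \in s by have := eS z; rewrite !inE eqxx eq_sym (negbTE uz).
case/splitPr: zs us eS lS p => s1 s2.
case: s2 => [|y s2] us eS lS; first by rewrite last_cat /= in lS; rewrite lS eqxx in vz.
rewrite cat_path /= => /and4P[p1 xz zy p2].
have us' : uniq (z :: (u :: s1) ++ y :: s2).
  by move: us; rewrite -[in X in X -> _](cat1s z) -cat_cons uniq_catCA.
exists (last u s1), y; split=> //; apply: hsplit_cat p1 p2.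
- by case/andP: us'.
- move=> w; have [->|wz] := eqVneq w z.
    by rewrite (negbTE zS); apply/negbTE; case/andP: us'.
  by have := eS w; rewrite -!cat_cons !mem_cat !inE (negbTE wz).
- by rewrite last_cat in lS.
Qed.

(** A path without repetition uses the extra pair at most once, since its first end is never met
    again. *)
Lemma path_cut (r : rel V) (e : {set V}) u s : uniq (u :: s) ->
  path (fun x y => r x y || ([set x; y] == e)) u s ->
  path r u s \/ exists s1 y s2, [/\ s = s1 ++ y :: s2, path r u s1 & path r y s2].
Proof.
elim: s u => [|y s IH] u; first by left.
rewrite cons_uniq => /andP[us uys] /= /andP[ruy p].
have [ry|nry] := boolP (r u y).
  have [q|[s1 [z [s2 [-> p1 p2]]]]] := IH y uys p; first by left.
  by right; exists (y :: s1), z, s2; rewrite /= ry.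
right; exists [::], y, s; split=> //.
have e2 : [set u; y] = e by move: ruy; rewrite (negbTE nry) => /eqP.
apply: (path_mono (S := [set~ u])) uys _ _ p.
  by move=> z zs; rewrite !inE; apply: contraNneq us => <-.
move=> a b; rewrite !inE => au bu _ /orP[//|/eqP ab].
by have := set21 u y; rewrite e2 -ab !inE eq_sym (negbTE au) eq_sym (negbTE bu).
Qed.

Lemma setD1_fault S FV z : z \in FV :&: S -> S :\: (FV :\ z) = z |: (S :\: FV).
Proof.
rewrite inE => /andP[zF zS]; apply/setP => x; rewrite !inE.
by case: eqP => [->|]; rewrite ?zS.
Qed.

Lemma nfaults_D1v S FV FE z : z \in FV :&: S ->
  nfaults S FV FE = (nfaults S (FV :\ z) FE).+1.
Proof. by move=> h; rewrite /nfaults setIDAC (cardsD1_in h). Qed.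

Lemma nfaults_D1e S FV FE e : e \in pairs_in FE S ->
  nfaults S FV FE = (nfaults S FV (FE :\ e)).+1.
Proof.
move=> h; rewrite /nfaults (cardsD1_in h) addnS; congr (_ + _).+1.
by apply: eq_card => x; rewrite !inE andbA.
Qed.

Lemma nfaults_ex S FV FE f : nfaults S FV FE = f.+1 ->
  (exists z, z \in FV :&: S) \/ (exists e, e \in pairs_in FE S).
Proof.
move=> nf; have : 0 < nfaults S FV FE by rewrite nf.
by rewrite /nfaults addn_gt0 => /orP[] /card_gt0P; [left|right].
Qed.

Lemma live_edgeD1 adj FE e x y :
  live_edge adj (FE :\ e) x y -> live_edge adj FE x y || ([set x; y] == e).
Proof.
by rewrite /live_edge !inE => /andP[->]; rewrite negb_and negbK orbC.
Qed.

(* One fault more than the tolerance: restore it, and cut the path there. *)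
Lemma tolerant_connected_cut S adj f FV FE u v : tolerant_connected S adj f ->
  nfaults S FV FE = f.+1 -> u \in S :\: FV -> v \in S :\: FV -> u != v ->
  exists x y, hsplit (live_edge adj FE) (S :\: FV) u v x y.
Proof.
move=> tc nf uS vS uv.
have [[z zS]|[e eS]] := nfaults_ex nf.
  have [zF zS'] : z \in FV /\ z \in S by apply/andP; rewrite -in_setI.
  have zuv w : w \in S :\: FV -> w != z.
    by rewrite inE => /andP[wF _]; apply: contraNneq wF => ->.
  have le : nfaults S (FV :\ z) FE <= f by have := nfaults_D1v FE zS; lia.
  have := tc _ _ le u v; rewrite (setD1_fault zS) !in_setU1 uS vS !orbT.
  move=> /(_ isT isT uv) p; have zn : z \notin S :\: FV by rewrite inE zF.
  have [x [y [_ _ sp]]] := hsplit_remove p zn (zuv _ uS) (zuv _ vS).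
  by exists x, y.
have le : nfaults S FV (FE :\ e) <= f by have := nfaults_D1e FV eS; lia.
have [s [us eSs lS p]] := tc _ _ le u v uS vS uv.
have := path_cut us (sub_path (@live_edgeD1 adj FE e) p).
move=> [q|[s1 [y [s2 [es p1 p2]]]]].
  case: s us eSs lS p q => [|y s] us eSs lS p /=; first by rewrite -lS eqxx in uv.
  move=> /andP[_ q]; exists u, y.
  exact: (@hsplit_cat _ _ _ u [::] y s).
rewrite es last_cat in us eSs lS.
by exists (last u s1), y; apply: hsplit_cat p1 p2.
Qed.

(** One fault is restored, which gives a Hamiltonian cycle; the cycle is then opened at that
    fault. *)
Lemma tolerant_cyclic_cut S adj f FV FE : symmetric adj -> tolerant_cyclic S adj f ->
  nfaults S FV FE = f.+1 ->
  exists x y, x != y /\ hpath (live_edge adj FE) (S :\: FV) x y.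
Proof.
move=> adjC tc nf.
have [[z zS]|[e eS]] := nfaults_ex nf.
  have [zF zS'] : z \in FV /\ z \in S by apply/andP; rewrite -in_setI.
  have le : nfaults S (FV :\ z) FE <= f by have := nfaults_D1v FE zS; lia.
  have := tc _ _ le; rewrite (setD1_fault zS) => /hcycle_rot/(_ (setU11 _ _)).
  move=> [y [s [us es s0]]] /=; rewrite rcons_path => /and3P[_ p _].
  exists y, (last y s); split.
    case: s us s0 {es p} => //= w s /and3P[_ + _] _.
    by apply: contraNneq => ->; apply: mem_last.
  exists s; split=> //; first by case/andP: us.
  move=> w; have [->|wz] := eqVneq w z.
    by rewrite in_setD zF; apply/negbTE; case/andP: us.
  by have := es w; rewrite in_setU1 (in_cons z) (negbTE wz).
have le : nfaults S FV (FE :\ e) <= f by have := nfaults_D1e FV eS; lia.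
have hc := tc _ _ le.
have /cards2P[x [y [xy ee]]] : #|e| == 2 by move: eS; rewrite inE => /and3P[].
(* If [x] is itself faulty, the cycle cannot use [e] and may be opened anywhere. *)
have [xS|xS] := boolP (x \in S :\: FV); last first.
  have [|a [b [_ _ ab p]]] := hcycle_cut (A := set0) (B := set0) hc.
    rewrite set0I cards0; have [s [us es s3 _]] := hc.
    by rewrite -(size_enumeration us es); lia.
  exists a, b; split=> //; apply: hpath_mono p => c d cS dS _ /live_edgeD1.
  case/orP => // /eqP cde; have := set21 x y; rewrite -ee -cde !inE.
  by case/orP => /eqP xe; rewrite xe ?cS ?dS in xS.
have [y1 [s [us es s0 p]]] := hcycle_rot hc xS.
have pi : path (live_edge adj FE) y1 s.
  have : path (live_edge adj (FE :\ e)) y1 s.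
    by move: p; rewrite /= rcons_path => /and3P[].
  case/andP: (us) => xs us'; apply: (path_mono (S := [set~ x])) us' _ _.
    by move=> z zs; rewrite !inE; apply: contraNneq xs => <-.
  move=> a b; rewrite !inE => ax bx _ /live_edgeD1/orP[//|/eqP ab].
  by have := set21 x y; rewrite -ee -ab !inE eq_sym (negbTE ax) eq_sym (negbTE bx).
move: p; rewrite /= rcons_path => /and3P[xy1 _ lx].
have y1s : y1 != last y1 s.
  case: s us s0 {es pi lx} => //= w s /and3P[_ + _] _.
  by apply: contraNneq => ->; apply: mem_last.
have keep c : c != x -> c != y -> live_edge adj (FE :\ e) x c -> live_edge adj FE x c.
  move=> cx cy /live_edgeD1/orP[//|/eqP xc].
  by have := set22 x c; rewrite xc ee !inE (negbTE cx) (negbTE cy).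
have nx c : c \in y1 :: s -> c != x.
  by move=> cs; case/andP: us => + _; apply: contraNneq => <-.
(* The two cycle neighbours of [x] differ, so one of them is not [y]; the cycle is opened on the
   other side of [x]. *)
have [y1y|y1y] := eqVneq y1 y; last first.
  exists x, (last y1 s); split; first by rewrite eq_sym nx // mem_last.
  by exists (y1 :: s); split; rewrite //= pi keep ?nx ?mem_head.
exists y1, x; split; first by rewrite nx ?mem_head.
exists (rcons s x); split.
- by rewrite -rcons_cons rcons_uniq.
- by move=> w; rewrite -rcons_cons mem_rcons es.
- by rewrite last_rcons.
rewrite rcons_path pi live_edge_sym // keep ?nx ?mem_last -?y1y 1?eq_sym //.
by rewrite live_edge_sym.
Qed.

Lemma tolerant_split_large S adj f : tolerant_connected S adj f ->
  f.*2 + 8 <= #|S| -> tolerant_split S adj f.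
Proof.
move=> tc leS FV FE D u v nf nfD uS vS uv.
apply: hpath_split (tc _ _ nf _ _ uS vS uv) _.
have := subset_leq_card (subsetIl D (S :\: FV)).
have : #|S :\: FV| + #|FV :&: S| = #|S|.
  by rewrite setIC addnC cardsID.
move: nf nfD; rewrite /nfaults; lia.
Qed.

(* The extra vertex [z], adjacent to everything outside [D], stands for the
   detour that will be spliced in between [x] and [y]. *)
Lemma tolerant_split_complete S adj f z :
  {in S &, forall x y, x != y -> adj x y} -> z \notin S -> 0 < f ->
  #|S| = f + 4 -> tolerant_split S adj f.
Proof.
move=> adjT zS f0 cS FV FE D u v nf nfD uS vS uv.
pose B := z |: (S :\: FV).
pose M := pairs_in FE S :|: [set [set z; d] | d in D].
have zS' : z \notin S :\: FV by rewrite inE negb_and zS orbT.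
have cB : #|B| = #|S :\: FV|.+1 by rewrite cardsU1 zS'.
have cSF : #|S :\: FV| + #|FV :&: S| = #|S| by rewrite setIC addnC cardsID.
have leM : #|pairs_in M B| <= #|pairs_in FE S| + #|D|.
  apply: leq_trans (subset_leq_card (_ : _ \subset M)) _.
    by apply/subsetP => e; rewrite inE => /andP[].
  apply: leq_trans (leq_card_setU _ _) _.
  by rewrite leq_add2l leq_imset_card.
have p : hpath (free_pair M) B u v.
  apply: free_hpath; rewrite ?in_setU1 ?uS ?vS ?orbT //.
  by move: nf nfD; rewrite /nfaults; lia.
have nz w : w \in S :\: FV -> w != z by move=> wS; apply: contraNneq zS' => <-.
have [x [y [xz zy sp]]] := hsplit_remove p zS' (nz _ uS) (nz _ vS).
have nD w : free_pair M z w -> w \notin D.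
  by case/andP => _; apply: contra => wD; apply/setUP; right; apply: imset_f.
exists x, y; split; [by apply: nD; rewrite free_pair_sym|exact: nD|].
apply: hsplit_mono sp => a b; rewrite !in_setD => /andP[_ aS] /andP[_ bS] ab.
case/andP => _; rewrite /live_edge adjT // in_setU negb_or => /andP[+ _].
apply: contra => abF; rewrite inE abF cards2 ab /=.
by apply/subsetP => w; rewrite !inE => /orP[]/eqP->.
Qed.

(** A Hamiltonian path of a complete graph can be made to use any step other than the one joining
    its ends. If [x] or [y] is an end, this dictates the direction of the step. *)
Lemma complete_split_through (r : rel V) S u v x y :
  {in S &, forall x y, x != y -> r x y} ->
  u \in S -> v \in S -> x \in S -> y \in S -> u != v -> x != y ->
  [set x; y] != [set u; v] -> hsplit r S u v x y \/ hsplit r S u v y x.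
Proof.
move=> rT uS vS xS yS uv xy ne.
have full S' a b : S' \subset S -> a \in S' -> b \in S' -> a != b -> hpath r S' a b.
  move=> /subsetP sub aS bS ab; apply: hpath_mono (hpath_neqrel aS bS ab).
  by move=> c d /sub cS /sub dS cd _; apply: rT.
have head1 a : a \in S -> a != u -> a != v -> hsplit r S u v u a.
  move=> aS au av; exists [set u], (S :\ u); split; rewrite ?setD1K //.
  - by rewrite disjoints1 !inE eqxx.
  - exact: hpath1.
  - by apply: full => //; rewrite ?subsetDl // in_setD1 ?au // vS eq_sym uv.
have last1 a : a \in S -> a != u -> a != v -> hsplit r S u v a v.
  move=> aS au av; exists (S :\ v), [set v]; split; rewrite 1?setUC ?setD1K //.
  - by rewrite disjoint_sym disjoints1 !inE eqxx.
  - apply: full; rewrite ?subsetDl // ?in_setD1 ?av ?uv //.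
    by rewrite eq_sym.
  - exact: hpath1.
have [xu|xu] := eqVneq x u.
  left; rewrite xu; apply: head1; rewrite // -1?xu 1?eq_sym //.
  by apply: contraNneq ne => ->; rewrite xu.
have [yu|yu] := eqVneq y u.
  right; rewrite yu; apply: head1; rewrite // -1?yu //.
  by apply: contraNneq ne => ->; rewrite yu setUC.
have [yv|yv] := eqVneq y v.
  by left; rewrite yv; apply: last1; rewrite // -yv.
have [xv|xv] := eqVneq x v.
  by right; rewrite xv; apply: last1; rewrite // -xv eq_sym.
left; exists [set u; x], (S :\: [set u; x]); split.
- by rewrite -{1}(setID S [set u; x]); congr (_ :|: _); apply/setIidPr;
     rewrite subUset !sub1set uS.
- by rewrite -setI_eq0 setIDA setIC -setIDA setDv setI0.
- by apply: full; rewrite ?set21 ?set22 // ?subUset ?sub1set ?uS // eq_sym.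
- apply: full => //; rewrite ?subsetDl // in_setD in_set2 negb_or ?yS ?vS andbT.
  + by rewrite yu eq_sym.
  + by rewrite eq_sym uv eq_sym.
Qed.

End Tolerance.

(** * Transport along an injective homomorphism *)

Section Transport.
Variables (V W : finType) (phi : V -> W) (S : {set V}).
Variables (adj : rel V) (adj' : rel W).
Hypothesis phi_inj : {in S &, injective phi}.
Hypothesis phi_adj : {in S &, forall x y, adj x y -> adj' (phi x) (phi y)}.

Lemma imset_inj_sub : {in [pred A : {set V} | A \subset S] &,
  injective (fun A : {set V} => phi @: A)}.
Proof.
move=> A B; rewrite !inE => /subsetP AS /subsetP BS e; apply/setP => x.
apply/idP/idP => h.
  have /imsetP[y yB exy] : phi x \in phi @: B by rewrite -e imset_f.
  by rewrite (phi_inj (AS x h) (BS y yB) exy).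
have /imsetP[y yA exy] : phi x \in phi @: A by rewrite e imset_f.
by rewrite (phi_inj (BS x h) (AS y yA) exy).
Qed.

Lemma hpath_imset (r : rel V) (r' : rel W) (A : {set V}) u v :
  A \subset S -> {in A &, forall x y, r x y -> r' (phi x) (phi y)} ->
  hpath r A u v -> hpath r' (phi @: A) (phi u) (phi v).
Proof.
move=> /subsetP AS rr' [s [us es ls p]]; exists (map phi s); split.
- rewrite -map_cons map_inj_in_uniq // => x y; rewrite !es => /AS xS /AS yS.
  exact: phi_inj.
- move=> w; rewrite -map_cons; apply/mapP/imsetP => -[x xs ->]; exists x;
    by rewrite ?es // -es.
- by rewrite last_map ls.
have {es} sA : {subset u :: s <= A} by move=> x; rewrite es.
elim: s u {us ls} p sA => //= y s IH u /andP[ruy p] sA.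
rewrite rr' ?sA ?mem_head ?inE ?eqxx ?orbT //=; apply: IH => // z zs.
by apply: sA; rewrite inE zs orbT.
Qed.

Lemma hcycle_imset (r : rel V) (r' : rel W) (A : {set V}) : A \subset S ->
  {in A &, forall x y, r x y -> r' (phi x) (phi y)} ->
  hcycle r A -> hcycle r' (phi @: A).
Proof.
move=> AS rr' hc; have [s [us es s3 _]] := hc.
have [x xA] : exists x, x \in A.
  by case: s us es s3 => // x s _ es _; exists x; rewrite -es mem_head.
have [y [s' [us' es' _ p]]] := hcycle_rot hc xA.
move: p; rewrite rcons_path => /andP[p lx].
have hp : hpath r A x (last x (y :: s')) by exists (y :: s').
have [hx hl] := hpath_ends hp.
apply: hcycle_close (hpath_imset AS rr' hp) _ _; first exact: rr'.
rewrite card_in_imset -?(size_enumeration us es) // => a b /(subsetP AS) aS /(subsetP AS) bS.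
exact: phi_inj.
Qed.

(** Faults are pulled back along [phi]; by injectivity their number does not grow, and a route
    avoiding them maps to one avoiding the original faults. *)
Definition vfaults_of (FV : {set W}) := [set x in S | phi x \in FV].
Definition efaults_of (FE : {set {set W}}) :=
  [set e : {set V} | (e \subset S) && (phi @: e \in FE)].

Lemma nfaults_of FV FE :
  nfaults S (vfaults_of FV) (efaults_of FE) <= nfaults (phi @: S) FV FE.
Proof.
apply: leq_add.
  rewrite -(card_in_imset (f := phi)).
    apply/subset_leq_card/subsetP => y /imsetP[x + ->].
    by rewrite !inE => /andP[/andP[xS xF] _]; rewrite xF imset_f.
  by move=> x y; rewrite !inE => /andP[_ xS] /andP[_ yS]; apply: phi_inj.
rewrite -(card_in_imset (f := fun A : {set V} => phi @: A)).
  apply/subset_leq_card/subsetP => y /imsetP[e + ->].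
  rewrite !inE => /and3P[/andP[eS eF] e2 _]; rewrite eF imsetS // andbT.
  rewrite card_in_imset // => a b /(subsetP eS) aS /(subsetP eS) bS.
  exact: phi_inj.
move=> A B; rewrite !inE => /and3P[_ _ AS] /and3P[_ _ BS].
exact: imset_inj_sub.
Qed.

Lemma imset_alive FV : phi @: (S :\: vfaults_of FV) = phi @: S :\: FV.
Proof.
apply/setP => y; rewrite in_setD; apply/imsetP/andP => [[x + ->]|[yF]].
  by rewrite !inE => /andP[+ xS]; rewrite xS imset_f.
by case/imsetP => x xS ey; exists x; rewrite // !inE xS -ey yF.
Qed.

Lemma live_edge_of FE : {in S &, forall x y,
  live_edge adj (efaults_of FE) x y -> live_edge adj' FE (phi x) (phi y)}.
Proof.
move=> x y xS yS; rewrite /live_edge => /andP[xy]; rewrite phi_adj //=.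
apply: contra; rewrite inE subUset !sub1set xS yS /=.
by rewrite imsetU1 imset_set1.
Qed.

Let aliveS (FV : {set V}) : S :\: FV \subset S := subsetDl S FV.

Lemma live_edge_of_alive FV FE : {in S :\: FV &, forall x y,
  live_edge adj (efaults_of FE) x y -> live_edge adj' FE (phi x) (phi y)}.
Proof. by move=> x y /setDP[xS _] /setDP[yS _]; apply: live_edge_of. Qed.

Lemma tolerant_connected_transport f :
  tolerant_connected S adj f -> tolerant_connected (phi @: S) adj' f.
Proof.
move=> tc FV FE nf u' v'; rewrite -imset_alive => /imsetP[u uS ->] /imsetP[v vS ->] uv.
apply: hpath_imset (@live_edge_of_alive _ FE) _ => //.
apply: tc uS vS _; first exact: leq_trans (nfaults_of _ _) nf.
by apply: contraNneq uv => ->.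
Qed.

Lemma tolerant_cyclic_transport f :
  tolerant_cyclic S adj f -> tolerant_cyclic (phi @: S) adj' f.
Proof.
move=> tc FV FE nf; rewrite -imset_alive.
apply: hcycle_imset (@live_edge_of_alive _ FE) _ => //.
by apply: tc; apply: leq_trans (nfaults_of _ _) nf.
Qed.

End Transport.

Lemma hcycle_open (V : finType) (r : rel V) S x : hcycle r S -> x \in S ->
  exists y z, [/\ y != z, hpath r (S :\ x) y z, r x y & r z x].
Proof.
move=> hc xS; have [y [s [us es s0 p]]] := hcycle_rot hc xS.
move: p; rewrite rcons_path => /andP[/= /andP[xy p] lx].
exists y, (last y s); split=> //.
  case: s us s0 {es p lx} => //= w s /and3P[_ + _] _.
  by apply: contraNneq => ->; apply: mem_last.
exists s; split=> //; first by case/andP: us.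
move=> w; have [->|wx] := eqVneq w x.
  by rewrite in_setD1 eqxx; apply/negbTE; case/andP: us.
by have := es w; rewrite in_setD1 (in_cons x) (negbTE wx).
Qed.

(** * The next level as arcs between copies *)

Section Arcs.
Variable C : finType.

(* The vertex of copy [a] whose outer edge leads to copy [b] is the arc (a, b). *)
Definition arcs : {set C * C} := [set p | p.1 != p.2].
Definition copy a : {set C * C} := [set p in arcs | p.1 == a].
Definition out (l : seq C) : {set C} := [set x | x \notin l].
(** A union of whole copies, cut down to [L]; routes are assembled as Hamiltonian paths of such
    sets. *)
Definition cov (L : {set C * C}) (B : {set C}) := [set p in L | p.1 \in B].

Lemma cov_out0 L : cov L (out [::]) = L.
Proof. by apply/setP => p; rewrite !inE andbT. Qed.

Lemma card_copy a : #|copy a| = #|C|.-1.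
Proof.
rewrite -(cardsT C) (cardsD1_in (in_setT a)) /= -(card_imset (f := pair a)).
  apply: eq_card => -[x y]; rewrite !inE; apply/andP/imsetP.
    by move=> [/= xy /eqP e]; subst x; exists y; rewrite // !inE eq_sym xy.
  by move=> [z + [-> ->]] /=; rewrite !inE eq_sym eqxx andbT.
by move=> x y [].
Qed.

(** * Lifting paths of the contracted graph *)

Section Routing.
Variables (r : rel (C * C)) (L : {set C * C}).
Hypothesis r_sym : symmetric r.

Definition link a b := [&& (a, b) \in L, (b, a) \in L & r (a, b) (b, a)].
Definition connected a := forall i j, (a, i) \in L -> (a, j) \in L -> i != j ->
  hpath r (cov L [set a]) (a, i) (a, j).

Lemma link_sym : symmetric link.
Proof. by move=> a b; rewrite /link r_sym andbCA. Qed.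

Lemma cov_disjoint (A B : {set C}) : [disjoint A & B] -> [disjoint cov L A & cov L B].
Proof.
move=> dis; rewrite -setI_eq0; apply/eqP/setP => p; rewrite !inE.
by apply/negbTE; apply/negP => /andP[/andP[_ pA] /andP[_]]; rewrite (disjointFr dis).
Qed.

Lemma covU (A B : {set C}) : cov L (A :|: B) = cov L A :|: cov L B.
Proof. by apply/setP => p; rewrite !inE andb_orr. Qed.

Lemma out_cons c l : c \notin l -> out l = [set c] :|: out (c :: l).
Proof.
by move=> cl; apply/setP => x; rewrite !inE negb_or; case: eqP => //= ->.
Qed.

Lemma out_cons_disjoint c l : [disjoint [set c] & out (c :: l)].
Proof. by rewrite disjoints1 !inE eqxx. Qed.

Lemma route_front c d l s q : hpath r (cov L [set c]) s (c, d) -> link c d ->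
  hpath r (cov L (out (c :: l))) (d, c) q -> c \notin l ->
  hpath r (cov L (out l)) s q.
Proof.
move=> p1 /and3P[_ _ rcd] p2 cl; rewrite (out_cons cl) covU.
by apply: hpath_cat p1 p2 rcd _; apply: cov_disjoint; apply: out_cons_disjoint.
Qed.

Lemma route_back c d l s q : hpath r (cov L (out (c :: l))) s (d, c) -> link d c ->
  hpath r (cov L [set c]) (c, d) q -> c \notin l ->
  hpath r (cov L (out l)) s q.
Proof.
move=> p1 /and3P[_ _ rcd] p2 cl; rewrite (out_cons cl) covU setUC.
apply: hpath_cat p1 p2 rcd _; apply: cov_disjoint; rewrite disjoint_sym.
exact: out_cons_disjoint.
Qed.

(** The gap in the path of copy [a] is filled by a tour of all other copies. *)
Lemma route_splice a p q u v : hsplit r (cov L [set a]) u v (a, p) (a, q) ->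
  link a p -> link q a -> hpath r (cov L (out [:: a])) (p, a) (q, a) ->
  hpath r L u v.
Proof.
move=> [S1 [S2 [eS dis p1 p2]]] /and3P[_ _ rap] /and3P[_ _ rqa] p3.
have dO : [disjoint S1 :|: S2 & cov L (out [:: a])].
  by rewrite -eS; apply: cov_disjoint; apply: out_cons_disjoint.
have -> : L = S1 :|: (cov L (out [:: a]) :|: S2).
  by rewrite setUCA -eS setUC -covU -out_cons // cov_out0.
move: dO; rewrite disjoints_subset subUset -!disjoints_subset => /andP[d1 d2].
apply: hpath_cat p1 (hpath_cat p3 p2 rqa _) rap _; first by rewrite disjoint_sym.
by rewrite disjoint_sym disjoints_subset subUset -!disjoints_subset ![[disjoint _ & S1]]disjoint_sym d1.
Qed.

(** Each copy is entered and left at different vertices because its predecessor and successor are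
    different copies; the extreme ones [i] and [j] lie outside the list, and only for a single copy
    could they clash. *)
Lemma route_list c cs i j : uniq (c :: cs) -> {in c :: cs, forall d, connected d} ->
  path link c cs -> i \notin c :: cs -> j \notin c :: cs -> (cs = [::] -> i != j) ->
  (c, i) \in L -> (last c cs, j) \in L ->
  hpath r (cov L [set x in c :: cs]) (c, i) (last c cs, j).
Proof.
elim: cs c i => [|d cs IH] c i.
  move=> _ con _ _ _ /(_ erefl) ij iL jL.
  have -> : [set x in [:: c]] = [set c] by apply/setP => x; rewrite !inE.
  by apply: con; rewrite ?mem_head.
rewrite cons_uniq => /andP[cd ucs] con /= /andP[lcd p] ic jc _ iL jL.
have /and3P[cdL dcL rcd] := lcd.
have -> : [set x in c :: d :: cs] = [set c] :|: [set x in d :: cs].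
  by apply/setP => x; rewrite !inE.
move: ic jc; rewrite !in_cons !negb_or => /and3P[_ id _] /and3P[jc jd js].
have p1 : hpath r (cov L [set c]) (c, i) (c, d) by apply: con => //; apply: mem_head.
have p2 : hpath r (cov L [set x in d :: cs]) (d, c) (last d cs, j).
  apply: IH => //; first by move=> x xs; apply: con; rewrite in_cons xs orbT.
  - by rewrite in_cons negb_or jd.
  - by rewrite eq_sym.
rewrite covU; apply: hpath_cat p1 p2 rcd _.
by apply: cov_disjoint; rewrite disjoints1 inE.
Qed.

Lemma route_core (e : rel C) B c d i j : hpath e B c d ->
  {in B &, forall x y, x != y -> e x y -> link x y} -> {in B, forall x, connected x} ->
  i \notin B -> j \notin B -> (c = d -> i != j) ->
  (c, i) \in L -> (d, j) \in L -> hpath r (cov L B) (c, i) (d, j).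
Proof.
move=> [s [us es <- p]] el con iB jB ij ciL djL.
have -> : B = [set x in c :: s] by apply/setP => x; rewrite inE es.
apply: route_list; rewrite ?es //.
- by move=> x; rewrite es; apply: con.
- apply: (path_mono (S := B)) us _ _ p; first by move=> x; rewrite es.
  by move=> x y; apply: el.
- by move=> s0; apply: ij; rewrite s0.
Qed.

End Routing.

(** * How faults damage the contracted graph *)

Variable ain : C -> rel C.
Definition arc_adj (p q : C * C) :=
  if p.1 == q.1 then ain p.1 p.2 q.2 else (p.2 == q.1) && (q.2 == p.1).

Section Damage.
Variables (FV : {set C * C}) (FE : {set {set C * C}}).

Definition ends (p : C * C) := [set p.1; p.2].
Definition tails (e : {set C * C}) := [set p.1 | p in e].
(** A faulty vertex (a, b) spoils the pair {a, b}, and so does the faulty outer edge between (a, b)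
    and (b, a). An edge fault inside a copy contributes only a singleton, which spoils no pair. *)
Definition damaged : {set {set C}} :=
  (ends @: (FV :&: arcs)) :|: (tails @: pairs_in FE arcs).
(** These are the live vertices of [a] without a usable outer edge. Faulty ones are left out, being
    already counted among the faults of the copy. *)
Definition dead a := [set b | [&& b != a, (a, b) \notin FV & [set a; b] \in damaged]].

Let N := nfaults arcs FV FE.
Let nf a := nfaults (copy a) FV FE.

Lemma card_damaged : #|damaged| <= N.
Proof.
apply: leq_trans (leq_card_setU _ _) _.
by apply: leq_add; apply: leq_imset_card.
Qed.

Lemma tails2 a b : tails [set (a, b); (b, a)] = [set a; b].
Proof.
apply/setP => x; apply/imsetP/set2P; last by case=> ->; [exists (a, b)|exists (b, a)];
  rewrite // !inE eqxx ?orbT.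
by move=> [p /set2P[->|->] ->]; [left|right].
Qed.

Lemma undamaged_link a b : a != b -> [set a; b] \notin damaged ->
  link (live_edge arc_adj FE) (arcs :\: FV) a b.
Proof.
move=> ab; rewrite in_setU negb_or => /andP[nV nE].
have alive x y : x != y -> [set x; y] = [set a; b] -> (x, y) \in arcs :\: FV.
  move=> xy exy; rewrite !inE /= xy andbT; apply: contra nV => xyF.
  by apply/imsetP; exists (x, y); rewrite ?inE ?xyF // /ends exy.
have ba : b != a by rewrite eq_sym.
rewrite /link (alive a b) // (alive b a) // 1?setUC //=.
rewrite /live_edge /arc_adj /= (negbTE ab) !eqxx /=.
apply: contra nE => eF; apply/imsetP; exists [set (a, b); (b, a)].
  rewrite !inE eF cards2 /= xpair_eqE (negbTE ab) /=.
  by apply/subsetP => p; rewrite !inE => /orP[]/eqP->; rewrite //= eq_sym.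
  exact: esym (tails2 a b).
Qed.

Lemma copy_sub a : copy a \subset arcs.
Proof. by apply/subsetP => p; rewrite !inE => /andP[]. Qed.

Lemma copy_disjoint a b : a != b -> copy a :&: copy b = set0.
Proof.
move=> ab; apply/setP => p; rewrite !inE; apply/negbTE/negP.
by move=> /andP[/andP[_ /eqP->] /andP[_]]; rewrite (negbTE ab).
Qed.

Lemma pairs_in_sub (V : finType) (F : {set {set V}}) (A B : {set V}) :
  A \subset B -> pairs_in F A \subset pairs_in F B.
Proof.
move=> AB; apply/subsetP => e; rewrite !inE => /and3P[-> -> eA] /=.
exact: subset_trans eA AB.
Qed.

Lemma pairs_in_disjoint (V : finType) (F : {set {set V}}) (A B : {set V}) :
  A :&: B = set0 -> pairs_in F A :&: pairs_in F B = set0.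
Proof.
move=> AB; apply/setP => e; rewrite !inE; apply/negbTE/negP.
move=> /andP[/and3P[_ /eqP e2 eA] /and3P[_ _ eB]].
by have /subset_leq_card : e \subset A :&: B; rewrite ?subsetI ?eA // AB cards0 e2.
Qed.

Lemma nfaults_two a b : a != b -> nf a + nf b <= N.
Proof.
move=> /copy_disjoint dis; rewrite /nf /nfaults addnACA; apply: leq_add.
  rewrite -cardsUI setIACA dis setI0 cards0 addn0.
  by apply: subset_leq_card; rewrite subUset !setIS ?copy_sub.
rewrite -cardsUI pairs_in_disjoint // cards0 addn0.
by apply: subset_leq_card; rewrite subUset !pairs_in_sub ?copy_sub.
Qed.

Lemma damagedP m : m \in damaged -> #|m| = 2 ->
  (exists2 p, p \in FV :&: arcs & m = ends p) \/
  (exists e, [/\ e \in pairs_in FE arcs, forall a, e \notin pairs_in FE (copy a)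
               & m = tails e]).
Proof.
move=> /setUP[/imsetP[p pF ->]|/imsetP[e eF ->]] m2; first by left; exists p.
right; exists e; split=> // a; apply/negP => ea.
have : tails e \subset [set a].
  apply/subsetP => _ /imsetP[p pe ->]; move: ea; rewrite !inE => /and3P[_ _ /subsetP/(_ p pe)].
  by rewrite !inE => /andP[].
by move/subset_leq_card; rewrite m2 cards1.
Qed.

(** Every dead vertex of [a] and every damaged pair away from [a] stems from a fault outside the
    copy, and distinct pairs need distinct faults. So nothing is charged twice. *)
Lemma nfaults_copy a :
  nf a + #|dead a| + #|pairs_in damaged (out [:: a])| <= N.
Proof.
pose A := (FV :&: arcs) :\: copy a; pose E := pairs_in FE arcs :\: pairs_in FE (copy a).
have eN : N = nf a + (#|A| + #|E|).
  rewrite /N /nf /nfaults -(cardsID (copy a) (FV :&: arcs)).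
  rewrite -setIA (setIidPr (copy_sub a)) -(cardsID (pairs_in FE (copy a)) (pairs_in FE arcs)).
  by rewrite (setIidPr (pairs_in_sub _ (copy_sub a))) addnACA.
rewrite eN -addnA leq_add2l.
have -> : #|dead a| = #|[set [set a; b] | b in dead a]|.
  rewrite card_in_imset // => x y; rewrite !inE => /andP[xa _] _.
  exact: set2_inj xa.
have dis : [set [set a; b] | b in dead a] :&: pairs_in damaged (out [:: a]) = set0.
  apply/setP => m; rewrite in_set0; apply/negbTE/negP.
  move=> /setIP[/imsetP[b _ ->]]; rewrite inE => /and3P[_ _ /subsetP/(_ a)].
  by rewrite set21 !inE eqxx => /(_ isT).
rewrite -cardsUI dis cards0 addn0.
apply: leq_trans (subset_leq_card _) _; last first.
- apply: leq_trans (leq_card_setU (ends @: A) (tails @: E)) _.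
  by apply: leq_add; apply: leq_imset_card.
apply/subsetP => m mX; apply/setUP.
have [mD m2] : m \in damaged /\ #|m| = 2.
  case/setUP: mX => [/imsetP[b + ->]|]; rewrite inE; last by case/and3P => ? /eqP.
  by case/and3P => ba _ ->; rewrite cards2 eq_sym ba.
have [[p pF em]|[e [eF ea em]]] := damagedP mD m2; last first.
  by right; apply/imsetP; exists e; rewrite // in_setD ea.
left; apply/imsetP; exists p => //; rewrite in_setD pF andbT.
move: pF; rewrite !inE => /andP[pF pp]; rewrite pp /=; apply/eqP => pa.
case/setUP: mX => [/imsetP[b + eb]|]; rewrite inE.
  case/and3P => ba abF _; case/negP: abF.
  have -> : b = p.2 by apply: (set2_inj ba); rewrite -eb em /ends pa.
  by rewrite -pa -surjective_pairing.
by case/and3P => _ _ /subsetP/(_ a); rewrite em /ends -pa set21 !inE eqxx => /(_ isT).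
Qed.

Lemma two_copies_cover a b : a != b -> nf a + nf b = N ->
  FV :&: copy a :|: FV :&: copy b = FV :&: arcs /\
  pairs_in FE (copy a) :|: pairs_in FE (copy b) = pairs_in FE arcs.
Proof.
move=> ab eN; have dis := copy_disjoint ab.
have le1 : #|FV :&: copy a| + #|FV :&: copy b| <= #|FV :&: arcs|.
  rewrite -cardsUI setIACA dis setI0 cards0 addn0.
  by apply: subset_leq_card; rewrite subUset !setIS ?copy_sub.
have le2 : #|pairs_in FE (copy a)| + #|pairs_in FE (copy b)| <= #|pairs_in FE arcs|.
  rewrite -cardsUI pairs_in_disjoint // cards0 addn0.
  by apply: subset_leq_card; rewrite subUset !pairs_in_sub ?copy_sub.
have aux x1 y1 x2 y2 s t : x1 + y1 + (x2 + y2) = s + t -> x1 + x2 <= s ->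
    y1 + y2 <= t -> s <= x1 + x2 /\ t <= y1 + y2 by lia.
split.
  apply/eqP; rewrite eqEcard subUset !setIS ?copy_sub //=.
  have := cardsUI (FV :&: copy a) (FV :&: copy b).
  rewrite setIACA dis setI0 cards0 addn0 => ->.
  exact: (aux _ _ _ _ _ _ eN le1 le2).1.
apply/eqP; rewrite eqEcard subUset !pairs_in_sub ?copy_sub //=.
  have := cardsUI (pairs_in FE (copy a)) (pairs_in FE (copy b)).
  rewrite pairs_in_disjoint // cards0 addn0 => ->.
  exact: (aux _ _ _ _ _ _ eN le1 le2).2.
Qed.

Lemma nfaults_two_cover a b x : nf a + nf b = N -> a != b -> x != a -> x != b ->
  nf x = 0.
Proof.
move=> eN ab xa xb; have [e1 e2] := two_copies_cover ab eN.
have dis (y : C) : x != y -> copy y :&: copy x = set0.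
  by move=> xy; apply: copy_disjoint; rewrite eq_sym.
apply/eqP; rewrite addn_eq0 !cards_eq0; apply/andP; split.
  rewrite -(setIidPr (copy_sub x)) setIA -e1 setIUl -!setIA !dis // !setI0 setU0.
  by [].
rewrite -(setIidPr (pairs_in_sub FE (copy_sub x))) -e2 setIUl.
by rewrite !pairs_in_disjoint ?dis // setU0.
Qed.

(** All faults lie inside the two copies, so no outer edge is itself faulty and damage can only come
    from a faulty vertex of [a] or [b]. *)
Lemma damaged_two a b x y : nf a + nf b = N -> a != b -> x != y ->
  [set x; y] \in damaged ->
  (x, y) \in FV /\ x \in [set a; b] \/ (y, x) \in FV /\ y \in [set a; b].
Proof.
move=> eN ab xy xyD; have [e1 e2] := two_copies_cover ab eN.
have xy2 : #|[set x; y]| = 2 by rewrite cards2 xy.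
have [[p + em]|[e [+ ea _]]] := damagedP xyD xy2; last first.
  by rewrite -e2 in_setU !(negbTE (ea _)).
rewrite -e1 => pF; have pab : p.1 \in [set a; b].
  by move: pF; rewrite !inE => /orP[] /and3P[_ _ ->]; rewrite ?orbT.
have {}pF : p \in FV by move: pF; rewrite !inE => /orP[] /andP[].
have [px|px] : p.1 = x \/ p.1 = y by apply/set2P; rewrite em /ends set21.
  left; have ey : y = p.2 by apply: (@set2_inj _ x); rewrite 1?eq_sym // em /ends px.
  by rewrite -px ey -surjective_pairing.
right; have ey : x = p.2 by apply: (@set2_inj _ y); rewrite // setUC em /ends px.
by rewrite -px ey -surjective_pairing.
Qed.

End Damage.
End Arcs.
Arguments arcs {C}.

Ltac distinct :=
  lazymatch goal with
  | |- is_true (link _ _ _ _) => try assumption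
  | |- hpath _ _ _ _ => try assumption
  | |- _ =>
    try done; rewrite ?inE ?negbK ?negb_or ?eqxx ?orbT /=;
    repeat match goal with |- is_true (_ && _) => apply/andP; split end;
    try done; try (by rewrite eq_sym); try (by apply/orP; right)
  end.

(** * The inductive step *)

Section Step.
Variables (C : finType) (ain : C -> rel C) (t g : nat).
Let adj := arc_adj ain.
Hypothesis card_C : #|C| = t.+1.
Hypothesis adj_sym : symmetric adj.
Hypothesis copy_connected : forall a, tolerant_connected (copy a) adj g.
Hypothesis copy_cyclic : forall a, tolerant_cyclic (copy a) adj g.+1.
Hypothesis copy_split : forall a, tolerant_split (copy a) adj g.
(** Either the copies are large compared with the number of faults, or they are small but complete,
    and completeness makes up for the lack of room. *)
Hypothesis size_t : g.*2 + 8 <= t \/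
  [/\ t = g + 4, 0 < g
    & forall a, {in copy a &, forall p q, p != q -> adj p q}].

Lemma t_bounds : g + 4 <= t /\ 5 <= t.
Proof. by case: size_t => [|[]]; lia. Qed.

Lemma pick_out (l : seq C) : size l < t.+1 -> exists x, x \notin l.
Proof.
rewrite -card_C => lt; have : [exists x, x \notin l].
  apply: contraLR lt; rewrite negb_exists -leqNgt => /forallP H.
  apply: leq_trans (card_size l); apply: subset_leq_card.
  by apply/subsetP => x _; have := H x; rewrite negbK.
by case/existsP => x; exists x.
Qed.

Lemma card_out (l : seq C) : uniq l -> #|out l| = t.+1 - size l.
Proof.
move=> ul; rewrite -card_C -(card_uniqP ul) -[#|C|](cardC (mem l)) addKn.
by apply: eq_card => x; rewrite !inE.
Qed.

Section Faulty.
Variables (FV : {set C * C}) (FE : {set {set C * C}}).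
Definition total_faults := nfaults arcs FV FE.
Definition copy_faults a := nfaults (copy a) FV FE.
Definition alive : {set C * C} := arcs :\: FV.
Definition live := live_edge adj FE.
Definition broken := damaged FV FE.
Definition route := hpath live.
Notation N := total_faults.
Notation nf := copy_faults.
Notation L := alive.
Notation r := live.
Notation M := broken.

Lemma live_sym : symmetric r.
Proof. exact: live_edge_sym. Qed.

Lemma cov_copy a : cov L [set a] = copy a :\: FV.
Proof. by apply/setP => p; rewrite !inE andbA. Qed.

Lemma in_arcs a i : ((a, i) \in L) = (a != i) && ((a, i) \notin FV).
Proof. by rewrite !inE andbC. Qed.

Lemma in_copy a i : ((a, i) \in copy a :\: FV) = ((a, i) \in L).
Proof. by rewrite !inE /= eqxx andbT. Qed.

Lemma copy_fst a p : p \in copy a :\: FV -> p = (a, p.2).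
Proof. by case: p => x y; rewrite !inE /= => /and3P[_ _ /eqP->]. Qed.

Lemma copy_clean a : nf a = 0 -> FV :&: copy a = set0 /\ pairs_in FE (copy a) = set0.
Proof. by move/eqP; rewrite addn_eq0 !cards_eq0 => /andP[/eqP-> /eqP->]. Qed.

Lemma connected_copy a : nf a <= g -> connected r L a.
Proof.
move=> le i j iL jL ij; rewrite cov_copy; apply: copy_connected => //.
- by rewrite in_copy.
- by rewrite in_copy.
- by rewrite xpair_eqE eqxx.
Qed.

Lemma link_free a b : free_pair M a b -> link r L a b.
Proof. by case/andP; apply: undamaged_link. Qed.

Lemma covD1 a w x : x != a -> cov (L :\ (a, w)) [set x] = cov L [set x].
Proof.
move=> xa; apply/setP => -[y z]; rewrite !inE /= xpair_eqE.
by case: (y =P x) => [->|]; rewrite ?andbF // (negbTE xa).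
Qed.

(* Starting with the outer edge of [u], the copy of [u] is entered again later,
   with [u] removed. *)
Lemma connectedD1 (a w x : C) : (x = a -> nf a < g) -> (x != a -> nf x <= g) ->
  connected r (L :\ (a, w)) x.
Proof.
move=> ha hx i j iL jL ij; have [xa|xa] := eqVneq x a; last first.
  by rewrite covD1 //; apply: connected_copy => //; [exact: hx|case/setD1P: iL|case/setD1P: jL].
subst x; have -> : cov (L :\ (a, w)) [set a] = copy a :\: ((a, w) |: FV).
  by apply/setP => p; rewrite !inE negb_or -!andbA.
apply: copy_connected.
- apply: leq_trans (ha erefl); rewrite /copy_faults /nfaults -addSn leq_add2r setIUl.
  apply: leq_trans (leq_card_setU _ _) _; rewrite -add1n leq_add2r.
  by apply: leq_trans (subset_leq_card (subsetIl _ _)) _; rewrite cards1.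
- by move: iL; rewrite !inE /= eqxx andbT negb_or -andbA.
- by move: jL; rewrite !inE /= eqxx andbT negb_or -andbA.
- by rewrite xpair_eqE eqxx.
Qed.

Lemma linkD1 a w x y : link r L x y -> (x, y) != (a, w) -> (y, x) != (a, w) ->
  link r (L :\ (a, w)) x y.
Proof. by move=> /and3P[xL yL rxy] nx ny; rewrite /link !in_setD1 nx ny xL yL. Qed.

Lemma route_detour a w v : (a, w) \in L -> link r L a w ->
  route (L :\ (a, w)) (w, a) v -> route L (a, w) v.
Proof.
move=> aL /and3P[_ _ raw] p; rewrite -(setD1K aL).
by apply: hpath_cons p raw _; rewrite !inE eqxx.
Qed.

Lemma in_arcs_neq x y : (x, y) \in L -> y != x.
Proof. by rewrite in_arcs eq_sym => /andP[]. Qed.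

(** * Opening the Hamiltonian cycle of a copy *)

Section CopyCycle.
Variable a : C.
Hypothesis le_nf_a : nf a <= g.+1.

Lemma cycle_a : hcycle r (cov L [set a]).
Proof. by rewrite cov_copy; apply: copy_cyclic. Qed.

Lemma card_cov_a : t - g.+1 <= #|cov L [set a]|.
Proof.
have cC : #|copy a| = t by rewrite card_copy card_C.
rewrite cov_copy leq_subLR -{1}cC -(cardsID FV (copy a)) leq_add2r.
by apply: leq_trans le_nf_a; rewrite setIC leq_addr.
Qed.

Lemma card_cov_a2 : 2 < #|cov L [set a]|.
Proof.
by apply: leq_trans card_cov_a; have [t4 _] := t_bounds; move: t4; clear; lia.
Qed.

Lemma in_cov_a p : p \in cov L [set a] -> exists2 x, p = (a, x) & (a, x) \in L.
Proof.
by case: p => y x; rewrite !inE /= => /andP[pL /eqP ya]; exists x; rewrite -?ya // !inE.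
Qed.

(** Each vertex to be avoided spoils the two cycle edges at it, hence the doubling. *)
Lemma cycle_a_cut (l : seq C) : (size l).*2 < #|cov L [set a]| ->
  exists p q, [/\ p \notin l, q \notin l, p != q, (a, p) \in L /\ (a, q) \in L
    & hpath r (cov L [set a]) (a, p) (a, q)].
Proof.
move=> lt; pose A := [set (a, x) | x in l].
have le1 : #|A :&: cov L [set a]| <= size l.
  apply: leq_trans (subset_leq_card (subsetIl _ _)) _.
  by apply: leq_trans (leq_imset_card _ _) (card_size l).
have [|x [y [xA yA xy p]]] := hcycle_cut (A := A) (B := A) cycle_a.
  by apply: leq_ltn_trans lt; rewrite -addnn leq_add.
have [/in_cov_a[x' ex xL] /in_cov_a[y' ey yL]] := hpath_ends p; subst x y.
exists x', y'; split=> //.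
- by apply: contra xA => x'l; apply: imset_f.
- by apply: contra yA => y'l; apply: imset_f.
- by apply: contraNneq xy => ->.
Qed.

End CopyCycle.

Lemma close_cycle a p q : 2 < #|L| -> hpath r (cov L [set a]) (a, p) (a, q) ->
  link r L a p -> link r L a q -> hpath r (cov L (out [:: a])) (q, a) (p, a) ->
  hcycle r L.
Proof.
move=> L2 hp /and3P[_ _ rap] laq hq.
apply: (hcycle_close (u := (a, p)) (v := (p, a))) => //; last by rewrite live_sym.
by rewrite -(cov_out0 L); apply: (route_front hp laq hq).
Qed.

(** * All faults inside one copy *)

Section Clean.
Variable a : C.
Hypothesis all_in_a : nf a = N.

Lemma clean_faults x : x != a -> nf x = 0.
Proof. by move=> /(nfaults_two FV FE); rewrite -/(nf x) -/(nf a) -/N all_in_a; clear; lia. Qed.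

(** The inequality [nfaults_copy] leaves room for nothing besides the faults of [a]. *)
Lemma clean_count : dead FV FE a = set0 /\ pairs_in M (out [:: a]) = set0.
Proof.
have : nf a + #|dead FV FE a| + #|pairs_in M (out [:: a])| <= N by apply: nfaults_copy.
rewrite all_in_a -addnA -{2}[N]addn0 leq_add2l leqn0 addn_eq0 !cards_eq0.
by case/andP => /eqP-> /eqP->.
Qed.

Lemma clean_link x y : x != a -> y != a -> x != y -> link r L x y.
Proof.
move=> xa ya xy; apply: link_free; rewrite /free_pair xy; apply/negP => xyM.
have [_ e] := clean_count; have := in_set0 [set x; y].
by rewrite -e inE xyM cards2 xy subUset !sub1set !inE xa ya.
Qed.

Lemma clean_link_a p : (a, p) \in L -> link r L a p.
Proof.
rewrite in_arcs => /andP[ap apF]; apply: link_free; rewrite /free_pair ap.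
apply/negP => apM; have [e _] := clean_count.
by have := in_set0 p; rewrite -e inE eq_sym ap apF apM.
Qed.

Lemma clean_alive x y : x != a -> x != y -> (x, y) \in L.
Proof.
move=> xa xy; rewrite in_arcs xy; apply/negP => xyF.
have [e _] := copy_clean (clean_faults xa).
by have := in_set0 (x, y); rewrite -e !inE xyF /= xy eqxx.
Qed.

Lemma clean_connected x : x != a -> connected r L x.
Proof. by move=> xa; apply: connected_copy; rewrite clean_faults. Qed.

Lemma clean_step x i j : x != a -> i != x -> j != x -> i != j ->
  hpath r (cov L [set x]) (x, i) (x, j).
Proof.
by move=> xa ix jx ij; apply: clean_connected; rewrite // clean_alive // eq_sym.
Qed.

Lemma clean_core (B : {set C}) c d i j : c \in B -> d \in B -> c != d ->
  a \notin B -> i \notin B -> j \notin B -> hpath r (cov L B) (c, i) (d, j).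
Proof.
move=> cB dB cd aB iB jB; have nB x y : x \in B -> y \notin B -> x != y.
  by move=> xB; apply: contraNneq => <-.
apply: (route_core (hpath_neqrel cB dB cd) _ _ iB jB).
- by move=> x y xB yB _ xy; apply: clean_link => //; apply: nB.
- by move=> x xB; apply: clean_connected; apply: nB.
- by move=> e; rewrite e eqxx in cd.
- by apply: clean_alive; apply: nB.
- by apply: clean_alive; apply: nB.
Qed.

Section Removed.
Variables (b w : C).
Hypotheses (ba : b != a) (g_gt0 : 0 < g).

Lemma clean_connectedD1 x : x != a -> connected r (L :\ (b, w)) x.
Proof.
move=> xa; apply: connectedD1 => [xb|_]; last by rewrite clean_faults.
by rewrite -xb clean_faults.
Qed.

Lemma clean_stepD1 x i j : x != a -> x != b -> i != x -> j != x -> i != j ->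
  hpath r (cov (L :\ (b, w)) [set x]) (x, i) (x, j).
Proof. by move=> xa xb; rewrite covD1 //; apply: clean_step. Qed.

Lemma clean_coreD1 (B : {set C}) c d i j : c \in B -> d \in B -> c != d ->
  a \notin B -> w \notin B -> i \notin B -> j \notin B -> c != b -> d != b ->
  hpath r (cov (L :\ (b, w)) B) (c, i) (d, j).
Proof.
move=> cB dB cd aB wB iB jB cb db; have nB x y : x \in B -> y \notin B -> x != y.
  by move=> xB; apply: contraNneq => <-.
apply: (route_core (hpath_neqrel cB dB cd) _ _ iB jB).
- move=> x y xB yB _ xy; apply: linkD1; rewrite ?xpair_eqE ?negb_and ?(nB _ w) ?orbT //.
  by apply: clean_link => //; apply: nB.
- by move=> x xB; apply: clean_connectedD1; apply: nB.
- by move=> e; rewrite e eqxx in cd.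
- by rewrite in_setD1 xpair_eqE (negbTE cb) clean_alive //; apply: nB.
- by rewrite in_setD1 xpair_eqE (negbTE db) clean_alive //; apply: nB.
Qed.
End Removed.
End Clean.

(** * Hamiltonian connectedness with g+1 faults *)

Section HamiltonianConnected.
Hypothesis le_N : N <= g.+1.

(** * No copy holds more than g faults *)

Section Spread.
Hypothesis le_nf : forall a, nf a <= g.

Lemma card_M : #|M| <= t - 3.
Proof. by have := card_damaged FV FE; have [] := t_bounds; rewrite -/M -/N; move: le_N; lia. Qed.

(** A path inside [a] drops a step whose two ends have usable outer edges, and a tour of the other t
    copies bridges the gap. *)
Lemma route_spread_same a i j : (a, i) \in L -> (a, j) \in L -> i != j ->
  route L (a, i) (a, j).
Proof.
move=> iL jL ij; have cnt : nf a + #|dead FV FE a| + #|pairs_in M (out [:: a])| <= N.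
  exact: nfaults_copy.
have [t4 t5] := t_bounds.
have [aoi aoj] : (a, i) != (a, j) /\ a \notin out [:: a] by rewrite xpair_eqE eqxx ij !inE eqxx.
have cO : #|out [:: a]| = t by rewrite card_out // subn1.
have iC : (a, i) \in copy a :\: FV by rewrite in_copy.
have jC : (a, j) \in copy a :\: FV by rewrite in_copy.
have alive p : (a, p) \in L -> p \notin dead FV FE a -> free_pair M a p.
  rewrite in_arcs => /andP[ap pF]; rewrite /free_pair ap; apply: contra => pM.
  by rewrite inE eq_sym ap pF.
have core p q : p != q -> (a, p) \in L -> (a, q) \in L ->
    p \notin dead FV FE a -> q \notin dead FV FE a ->
    hpath (free_pair M) (out [:: a]) p q ->
    hsplit r (cov L [set a]) (a, i) (a, j) (a, p) (a, q) -> route L (a, i) (a, j).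
  move=> pq pL qL pd qd hp sp; have lp := link_free (alive p pL pd).
  have lq := link_free (alive q qL qd).
  apply: (route_splice sp lp); first by rewrite link_sym //; apply: live_sym.
  apply: (route_core hp) => //.
  - by move=> x y _ _ _; apply: link_free.
  - by move=> x _; apply: connected_copy.
  - by move=> pq'; rewrite pq' eqxx in pq.
  - by case/and3P: lp.
  - by case/and3P: lq.
(* In the first case the other copies form a Hamiltonian-connected contracted graph, so the dropped
   step may be chosen before the tour. *)
have [m4|m3] := leqP (#|pairs_in M (out [:: a])| + 4) t.
  pose D := [set (a, b) | b in dead FV FE a].
  have cD : #|D| = #|dead FV FE a| by rewrite card_imset // => x y [].
  have [||x [y [xD yD sp]]] := copy_split (le_nf a) (D := D) _ iC jC _ => //.
    by rewrite cD -/(nf a); move: cnt le_N; lia.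
  have [xC yC] := hsplit_ends sp; have xy := hsplit_neq sp.
  move: (copy_fst xC) (copy_fst yC); move: x.2 y.2 => p q ex ey; subst x y.
  rewrite in_copy in xC; rewrite in_copy in yC.
  have pq : p != q by apply: contraNneq xy => ->.
  have nd x : (a, x) \notin D -> x \notin dead FV FE a.
    by apply: contra => pd; apply: imset_f.
  apply: (core _ _ pq xC yC (nd _ xD) (nd _ yD)); last by rewrite cov_copy.
  apply: free_hpath => //; last by rewrite cO.
    by rewrite in_arcs in xC; rewrite !inE eq_sym; case/andP: xC.
  by rewrite in_arcs in yC; rewrite !inE eq_sym; case/andP: yC.
(* Here all g+1 = t-3 faults damage pairs away from [a], so [a] is an intact complete graph. The
   other copies guarantee only a cycle: the tour is chosen first, and the path inside [a] is fitted
   to it. *)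
have [nfa0 dead0] : nf a = 0 /\ dead FV FE a = set0.
  by split; [|apply/eqP; rewrite -cards_eq0]; move: cnt le_N; lia.
have adjT : forall b, {in copy b &, forall p q, p != q -> adj p q}.
  by case: size_t => [|[]//]; move: le_N cnt; lia.
have hc : hcycle (free_pair M) (out [:: a]).
  by apply: free_hcycle; rewrite cO; move: le_N cnt; lia.
have [|p [q [pi qi pq hp]]] := hcycle_cut (A := [set i]) (B := [set i]) hc.
  have : #|[set i] :&: out [:: a]| <= 1.
    by rewrite -(cards1 i); apply: subset_leq_card; apply: subsetIl.
  by rewrite cO; lia.
have [pO qO] := hpath_ends hp; rewrite !inE in pi qi pO qO.
have noF x y : x != y -> x = a -> (x, y) \in L.
  move=> xy xa; rewrite in_arcs xy; apply/negP => xyF.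
  have [FV0 _] := copy_clean nfa0.
  by have := in_set0 (x, y); rewrite -FV0 !inE xyF /= xy xa eqxx.
have [pL qL] : (a, p) \in L /\ (a, q) \in L by rewrite !noF // eq_sym.
have nd p' : p' \notin dead FV FE a by rewrite dead0 inE.
have rT : {in cov L [set a] &, forall x y, x != y -> r x y}.
  move=> x y; rewrite !cov_copy => /setDP[xC _] /setDP[yC _] xy.
  rewrite /live /live_edge (adjT a x y xC yC xy) /=; apply/negP => xyF.
  have [_ FE0] := copy_clean nfa0; have := in_set0 [set x; y].
  by rewrite -FE0 inE xyF cards2 xy /= subUset !sub1set xC yC.
have := complete_split_through rT.
move=> /(_ (a, i) (a, j) (a, p) (a, q)); rewrite !cov_copy !in_copy iL jL pL qL aoi.
rewrite xpair_eqE eqxx pq => /(_ isT isT isT isT isT isT) [|sp|sp].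
- apply: contraNneq pi => e; have : (a, i) \in [set (a, p); (a, q)] by rewrite e set21.
  by rewrite !inE !xpair_eqE eqxx /= ![i == _]eq_sym (negbTE qi) orbF.
- by apply: (core _ _ pq pL qL (nd p) (nd q) hp); rewrite cov_copy.
apply: (core _ _ _ qL pL (nd q) (nd p)); rewrite ?cov_copy //; first by rewrite eq_sym.
by apply: hpath_sym hp; apply: free_pair_sym.
Qed.


Lemma out2E a b : out [:: b; a] = [set: C] :\ a :\ b.
Proof. by apply/setP => x; rewrite !inE andbT negb_or. Qed.

(** Damaged pairs away from both copies, those joining [a] to the rest and those joining [b] to the
    rest are disjoint families. *)
Lemma card_damaged_pairs a b : a != b ->
  #|pairs_in M (out [:: b; a])| + #|blocked M (out [:: b; a]) a| +
  #|blocked M (out [:: b; a]) b| <= #|M|.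
Proof.
move=> ab; rewrite out2E.
have e1 := card_pairs_in M [set: C] a; have e2 := card_pairs_in M ([set: C] :\ a) b.
have le0 : #|pairs_in M [set: C]| <= #|M|.
  by apply: subset_leq_card; apply/subsetP => e; rewrite inE => /andP[].
have le1 : #|blocked M ([set: C] :\ a :\ b) a| <= #|pairs_at M [set: C] a|.
  apply: leq_trans (card_blocked M (in_setT a)); apply: subset_leq_card.
  by apply/subsetP => x; rewrite !inE => /and3P[_ -> ->].
have le2 : #|blocked M ([set: C] :\ a :\ b) b| <= #|pairs_at M ([set: C] :\ a) b|.
  apply: leq_trans (card_blocked M (_ : b \in [set: C] :\ a)).
    apply: subset_leq_card; apply/subsetP => x; rewrite !inE.
    by case/and3P => /and3P[-> -> _] _ ->.
  by rewrite !inE eq_sym ab.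
by move: e1 e2 le0 le1 le2; lia.
Qed.

Lemma pick_distinct (P Q : {set C}) : 0 < #|P| -> 0 < #|Q| -> 2 < #|P| + #|Q| ->
  exists c d, [/\ c \in P, d \in Q & c != d].
Proof.
move=> P0 Q0 PQ; have [P1|P1] := ltnP 1 #|P|.
  have /card_gt0P[d dQ] := Q0.
  have /card_gt0P[c] : 0 < #|P :\ d|.
    by have := cardsD1 d P; case: (d \in P); lia.
  by rewrite !inE => /andP[cd cP]; exists c, d.
have /card_gt0P[c cP] := P0.
have /card_gt0P[d] : 0 < #|Q :\ c|.
  by have := cardsD1 c Q; case: (c \in Q); lia.
by rewrite !inE eq_sym => /andP[cd dQ]; exists c, d.
Qed.

Lemma route_ends a b i j c d : a != b -> (a, i) \in L -> (b, j) \in L ->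
  hpath (free_pair M) (out [:: b; a]) c d -> c != i -> d != j ->
  free_pair M a c -> free_pair M d b -> route L (a, i) (b, j).
Proof.
move=> ab iL jL hp ci dj /link_free lac /link_free ldb.
have /and3P[acL caL _] := lac; have /and3P[dbL bdL _] := ldb.
rewrite -(cov_out0 L); apply: (route_front (c := a) (d := c)) => //.
  by apply: connected_copy; rewrite // eq_sym.
apply: (route_back (c := b) (d := d)) => //.
- apply: (route_core hp) => //.
  + by move=> x y _ _ _; apply: link_free.
  + by move=> x _; apply: connected_copy.
  + by rewrite !inE eqxx orbT.
  + by rewrite !inE eqxx.
- exact: connected_copy.
- by rewrite inE eq_sym.
Qed.

(** Both ends face the same copy [w]. The start moves to [w] at once; a tour of all copies but [w],
    including [a] without its start, then ends in [b]. Its first copy [c] is not [a], since (w, a)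
    served as entry. *)
Lemma route_spread_common a b w : a != b -> (a, w) \in L -> (b, w) \in L ->
  free_pair M a w -> 0 < g -> nf a = 0 -> #|pairs_in M [set: C]| <= t - 3 ->
  route L (a, w) (b, w).
Proof.
move=> ab awL bwL faw g0 nfa leM; have [t4 t5] := t_bounds.
have [aw bw] : a != w /\ b != w by move: awL bwL; rewrite !in_arcs => /andP[-> _] /andP[-> _].
have cT : #|[set: C]| = t.+1 by rewrite cardsT.
have oT : out [:: w] = [set: C] :\ w by apply/setP => x; rewrite !inE andbT.
have cO : #|out [:: w]| = t by rewrite card_out ?subn1.
have e1 := card_pairs_in M [set: C] w; rewrite -oT in e1.
have bO : b \in out [:: w] by rewrite !inE.
(* If [w] is on no damaged pair, the two neighbours of [b] on a cycle offer a choice for [c].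
   Otherwise deleting [w] lowers the damage enough for Hamiltonian connectedness. *)
have [c [cb ca cw fwc hp]] : exists c, [/\ c != b, c != a, c != w,
    free_pair M w c & hpath (free_pair M) (out [:: w]) c b].
  have [e|] := eqVneq (pairs_at M [set: C] w) set0.
    have hc : hcycle (free_pair M) (out [:: w]).
      by apply: free_hcycle; rewrite cO; move: e1 leM t5; clear; lia.
    have [y [z [yz py pz]]] := hcycle_nbrs (@free_pair_sym _ M) hc bO.
    have good c : c != a -> hpath (free_pair M) (out [:: w]) b c ->
        [/\ c != b, c != a, c != w, free_pair M w c
          & hpath (free_pair M) (out [:: w]) c b].
      move=> ca pc; have [_] := hpath_ends pc; rewrite !inE => cw.
      split=> //; last by apply: hpath_sym pc; apply: free_pair_sym.
        by rewrite eq_sym; apply: hpath_neq pc; rewrite cO; apply: leq_trans t5.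
      by apply: (pairs_at0 (in_setT w) e); rewrite ?inE // eq_sym.
    have [ya|ya] := eqVneq y a; last by exists y; apply: good.
    by exists z; apply: good; rewrite // -ya eq_sym.
  rewrite -card_gt0 => Jw.
  have [|c [_ cX wc fwc]] := free_nbr (X := [set a; b]) (in_setT w) (M := M).
    by rewrite cards2 ab cT; lia.
  move: cX; rewrite !inE negb_or => /andP[ca cb]; exists c; split=> //.
    by rewrite eq_sym.
  apply: free_hpath; rewrite ?cO ?inE // 1?eq_sym //.
  by move: e1 Jw leM t5; clear; lia.
have con x : connected r (L :\ (a, w)) x by apply: connectedD1 => // _; rewrite nfa.
have lfree x y : x != w -> y != w -> free_pair M x y -> link r (L :\ (a, w)) x y.
  move=> xw yw fxy; apply: linkD1; rewrite ?xpair_eqE ?negb_and ?xw ?yw ?orbT //.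
  exact: link_free.
apply: route_detour awL (link_free faw) _.
rewrite -(cov_out0 (L :\ (a, w))).
have lwc : link r (L :\ (a, w)) w c.
  by apply: linkD1 (link_free fwc) _ _; rewrite xpair_eqE ?(eq_sym w) ?(negbTE aw) ?(negbTE ca).
have /and3P[wcL cwL _] := lwc.
apply: (route_front (c := w) (d := c)) => //.
  apply: con => //; last by rewrite eq_sym.
  have /and3P[_ waL _] := link_free faw.
  by rewrite in_setD1 waL xpair_eqE eq_sym (negbTE aw).
apply: (route_core hp) => //.
- move=> x y; rewrite !inE => xw yw _; exact: lfree.
- by rewrite inE mem_head.
- by rewrite inE mem_head.
- by move=> e; rewrite e eqxx in cb.
- by rewrite in_setD1 bwL xpair_eqE eq_sym (negbTE ab).
Qed.

(** Between [a] and [b] comes a tour of the other t-1 copies from some [c] to some [d]. At most t-3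
    pairs are damaged in all, so the more damage there is among these copies, the freer are the
    passages out of [a] and into [b]. *)
Lemma route_spread_distinct a b i j : a != b -> (a, i) \in L -> (b, j) \in L ->
  route L (a, i) (b, j).
Proof.
move=> ab iL jL; have [t4 t5] := t_bounds; have leM := card_M.
have cnt := card_damaged_pairs ab.
set S := out [:: b; a] in cnt; have cS : #|S| = t.-1.
  by rewrite card_out /= ?inE ?andbT 1?eq_sym //; lia.
have inS x : x \in S -> a != x /\ x != b.
  by rewrite !inE negb_or => /andP[-> xa]; rewrite eq_sym.
have fa c : c \in S -> c \notin blocked M S a -> free_pair M a c.
  by move=> cS'; apply: free_pairP => //; case: (inS c cS').
have fb d : d \in S -> d \notin blocked M S b -> free_pair M d b.
  move=> dS db; rewrite free_pair_sym; apply: free_pairP db => //.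
  by rewrite eq_sym; case: (inS d dS).
have ends c d : c \notin i |: blocked M S a -> d \notin j |: blocked M S b ->
    hpath (free_pair M) S c d -> route L (a, i) (b, j).
  rewrite !in_setU1 !negb_or => /andP[ci ca] /andP[dj db] hp.
  have [cS' dS'] := hpath_ends hp.
  exact: (route_ends ab iL jL hp ci dj (fa c cS' ca) (fb d dS' db)).
have cU x y : #|x |: blocked M S y| <= #|blocked M S y|.+1.
  by rewrite cardsU1 -add1n leq_add2r leq_b1.
have [m4|m4] := leqP (#|pairs_in M S| + 4) t.-1.
  have cP x y : #|S| <= #|S :\: (x |: blocked M S y)| + #|blocked M S y|.+1.
    rewrite -(cardsID (x |: blocked M S y) S) addnC leq_add2l.
    by apply: leq_trans (subset_leq_card (subsetIr _ _)) (cU _ _).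
  have [|||c [d [cP' dQ cd]]] :=
    @pick_distinct (S :\: (i |: blocked M S a)) (S :\: (j |: blocked M S b)).
  - by have := cP i a; lia.
  - by have := cP j b; lia.
  - by have := cP i a; have := cP j b; lia.
  move: cP' dQ => /setDP[cS' ci] /setDP[dS' dj].
  by apply: (ends c d) => //; apply: free_hpath; rewrite ?cS.
(* With exactly t-4 damaged pairs among the others, at most one passage is blocked, and a cycle can
   be cut to suit. *)
have [m3|m3] := leqP (#|pairs_in M S| + 3) t.-1.
  have hc : hcycle (free_pair M) S by apply: free_hcycle; rewrite cS; lia.
  have [|c [d [ci dj _ hp]]] :=
    hcycle_cut (A := i |: blocked M S a) (B := j |: blocked M S b) hc.
    apply: leq_ltn_trans (_ : #|blocked M S a|.+1 + #|blocked M S b|.+1 < _).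
      by apply: leq_add; apply: leq_trans (subset_leq_card (subsetIl _ _)) (cU _ _).
    by rewrite cS; lia.
  exact: ends ci dj hp.
(* With t-3 damaged pairs no passage is blocked, but the ends of the tour cannot be chosen. If [i]
   and [j] differ, one of its two directions fits. *)
have [ba0 bb0] : blocked M S a = set0 /\ blocked M S b = set0.
  by split; apply/eqP; rewrite -cards_eq0; lia.
have [eij|ij] := eqVneq i j; last first.
  have [||c [d hp]] := free_hpath_any (M := M) (B := S); rewrite ?cS; [lia|lia|].
  have cd : c != d by apply: hpath_neq hp; rewrite cS; move: t5; clear; lia.
  have [/andP[ci dj]|] := boolP ((c != i) && (d != j)).
    by apply: ends hp; rewrite ?ba0 ?bb0 setU0 inE.
  rewrite negb_and !negbK => cdij.
  apply: ends (hpath_sym (@free_pair_sym _ M) hp); rewrite ?ba0 ?bb0 setU0 inE.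
    by case/orP: cdij => /eqP e; rewrite eq_sym; [rewrite -e|rewrite e].
  by case/orP: cdij => /eqP e; [rewrite e|rewrite -e].
subst j; have [aw bw] : a != i /\ b != i.
  by move: iL jL; rewrite !in_arcs => /andP[-> _] /andP[-> _].
have iS : i \in S by rewrite !inE negb_or ![i == _]eq_sym bw aw.
have faw : free_pair M a i by apply: fa; rewrite // ba0 inE.
have cntN : nf a + #|dead FV FE a| + #|pairs_in M (out [:: a])| <= N.
  exact: nfaults_copy.
have le1 : #|pairs_in M S| <= #|pairs_in M (out [:: a])|.
  apply: subset_leq_card; apply: pairs_in_sub; apply/subsetP => x.
  by rewrite !inE negb_or => /andP[].
have le2 : #|pairs_in M [set: C]| <= #|M|.
  by apply: subset_leq_card; apply/subsetP => e; rewrite inE => /andP[].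
have leN := le_N; apply: route_spread_common => //; try lia.
Qed.

End Spread.

(** * One copy holds all g+1 faults *)

Section Concentrated.
Variable a : C.
Hypothesis nf_a : nf a = g.+1.

Lemma all_faults_in : nf a = N.
Proof.
apply/eqP; rewrite eqn_leq nf_a le_N andbT -nf_a.
by apply: leq_trans (leq_trans (leq_addr _ _) (leq_addr _ _)) (nfaults_copy FV FE a).
Qed.
Let eN := all_faults_in.
Let le_nf_a : nf a <= g.+1.
Proof. by rewrite nf_a. Qed.

(** Copy [a] has one fault too many for a path, but it still splits into two paths, and the intact
    copies bridge the gap. *)
Lemma route_both i j : (a, i) \in L -> (a, j) \in L -> i != j ->
  route L (a, i) (a, j).
Proof.
move=> iL jL ij.
have [x [y sp]] : exists x y, hsplit r (copy a :\: FV) (a, i) (a, j) x y.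
  apply: tolerant_connected_cut (@copy_connected a) nf_a _ _ _.
  - by rewrite in_copy.
  - by rewrite in_copy.
  - by rewrite xpair_eqE eqxx.
rewrite -cov_copy in sp; have [/in_cov_a[p ep pL] /in_cov_a[q eq qL]] := hsplit_ends sp.
have := hsplit_neq sp; subst x y; rewrite xpair_eqE eqxx /= => pq.
apply: (route_splice sp); first by apply: (clean_link_a eN).
  by rewrite link_sym; [apply: (clean_link_a eN)|apply: live_sym].
have [pa qa] := (in_arcs_neq pL, in_arcs_neq qL).
by apply: (clean_core eN); distinct.
Qed.

(** The start has two neighbours on the cycle of [a], so [a] can be left towards a copy [p] other
    than [c]. *)
Lemma route_one i c j : c != a -> (a, i) \in L -> (c, j) \in L ->
  route L (a, i) (c, j).
Proof.
move=> ca iL jL; have iS : (a, i) \in cov L [set a] by rewrite inE iL inE /=.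
have [p [pL pc hp]] : exists p, [/\ (a, p) \in L, p != c
    & hpath r (cov L [set a]) (a, i) (a, p)].
  have [y [z [yz py pz]]] := hcycle_nbrs live_sym (cycle_a le_nf_a) iS.
  have [_ /in_cov_a[y' ey yL]] := hpath_ends py.
  have [_ /in_cov_a[z' ez zL]] := hpath_ends pz; subst y z.
  have [y'c|] := eqVneq y' c; last by exists y'.
  by exists z'; split=> //; apply: contraNneq yz => ->; rewrite y'c.
have [t4 t5] := t_bounds.
(* [x] is visited just before [c]: it differs from [p] to give the tour two ends, and from [j] to
   leave the target free. *)
have [x] : exists x, x \notin [:: c; a; p; j] by apply: pick_out; apply: leq_trans t5 _.
rewrite !inE !negb_or => /and4P[xc xa xp xj].
have jc : j != c by move: jL; rewrite in_arcs eq_sym => /andP[].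
rewrite -(cov_out0 L); apply: (route_front (c := a) (d := p)) => //.
  by apply: (clean_link_a eN).
apply: (route_back (c := c) (d := x)); rewrite ?inE //.
- by have pa := in_arcs_neq pL; apply: (clean_core eN); distinct.
- by apply: (clean_link eN).
- by apply: (clean_step eN); distinct.
Qed.

(** Order of visit: p', the other copies, p, a, q, and then q' unless it equals q. *)
Lemma route_outer b p q p' q' : b != a -> p != q -> p' != q' ->
  (a, p) \in L -> (a, q) \in L -> p != b -> q != b ->
  hpath r (cov L [set a]) (a, p) (a, q) -> p' \notin [:: a; p; b] ->
  q' \notin [:: a; p; b] -> p' != q ->
  hpath r (cov L (out [:: b])) (p', b) (q', b).
Proof.
move=> ba pq pq' pL qL pb qb hp; rewrite !inE !negb_or => /and3P[pa' pp' pb'].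
move=> /and3P[qa' qp' qb'] pq2; have [pa qa] := (in_arcs_neq pL, in_arcs_neq qL).
have ab : a != b by rewrite eq_sym.
have back l : b \in l -> p' \notin l -> p \notin l -> a \notin l -> q \in l ->
    hpath r (cov L (out l)) (p', b) (a, q).
  move=> bl pl' pl al ql; apply: (route_back (c := a) (d := p)); distinct.
    by apply: (clean_core eN); distinct.
  by rewrite link_sym; [apply: (clean_link_a eN)|apply: live_sym].
have [eqq|qq'] := eqVneq q q'.
  subst q'; apply: (route_back (c := q) (d := a)); distinct.
  - by apply: back; distinct.
  - by apply: (clean_link_a eN).
  - by apply: (clean_step eN); distinct.
apply: (route_back (c := q') (d := q)); distinct.
- apply: (route_back (c := q) (d := a)); distinct.
  + by apply: back; distinct.
  + by apply: (clean_link_a eN).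
  + by apply: (clean_step eN); distinct.
- by apply: (clean_link eN).
- by apply: (clean_step eN); distinct.
Qed.

Lemma route_same b i j : b != a -> (b, i) \in L -> (b, j) \in L -> i != j ->
  route L (b, i) (b, j).
Proof.
move=> ba iL jL ij.
have [|p [q [pb qb pq [pL qL] hp]]] := @cycle_a_cut a le_nf_a [:: b]; first exact: (card_cov_a2 le_nf_a).
rewrite !inE in pb qb.
have nfb : nf b = 0 by apply: (clean_faults eN).
have [x [y [xD yD sp]]] : exists x y, [/\ x \notin [set (b, a); (b, p)],
    y \notin [set (b, a); (b, p)] & hsplit r (copy b :\: FV) (b, i) (b, j) x y].
  apply: copy_split; rewrite ?in_copy -?/(nf b) ?nfb //.
    rewrite add0n cards2; apply: leq_trans (leq_maxr _ _).
    by case: (_ != _).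
  by rewrite xpair_eqE eqxx.
have [xS yS] := hsplit_ends sp.
move: (copy_fst xS) (copy_fst yS); move: x.2 y.2 => p' q' ex ey; subst x y.
have := hsplit_neq sp; rewrite xpair_eqE eqxx /= => pq'.
rewrite !in_copy in xS yS; have [pb' qb'] := (in_arcs_neq xS, in_arcs_neq yS).
move: xD yD; rewrite !inE !xpair_eqE !eqxx /= !negb_or => /andP[pa' pp'] /andP[qa' qp'].
rewrite -cov_copy in sp.
apply: (route_splice sp).
- by apply: (clean_link eN); distinct.
- by apply: (clean_link eN); distinct.
(* Only one of p' and q' can equal [q]; if it is p', the tour is run backwards. *)
have [pq2|pq2] := eqVneq p' q; last first.
  by apply: (route_outer ba pq pq' pL qL) => //; distinct.
apply: hpath_sym live_sym _; apply: (route_outer ba pq _ pL qL) => //; distinct.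
by rewrite -pq2 eq_sym.
Qed.

Section Distinct.
Variables b c : C.
Hypotheses (ba : b != a) (ca : c != a) (bc : b != c).

(** Order of visit: b, p, a, q, the other copies, x, c. *)
Lemma route_via_fresh i j p q x : p != i ->
  (a, p) \in L -> (a, q) \in L -> (b, i) \in L -> (c, j) \in L ->
  p \notin [:: b; c; q] -> q \notin [:: b; c] -> x \notin [:: b; p; a; c; q; j] ->
  hpath r (cov L [set a]) (a, p) (a, q) -> route L (b, i) (c, j).
Proof.
move=> pi pL qL iL jL; rewrite !inE !negb_or => /and3P[pb pc pq] /andP[qb qc].
case/and5P => xb xp xa xc /andP[xq xj] hp.
have [pa qa] := (in_arcs_neq pL, in_arcs_neq qL).
have [ib jc] := (in_arcs_neq iL, in_arcs_neq jL).
rewrite -(cov_out0 L); apply: (route_front (c := b) (d := p)); distinct.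
- by apply: (clean_step eN); distinct.
- by apply: (clean_link eN); distinct.
apply: (route_front (c := p) (d := a)); distinct.
- by apply: (clean_step eN); distinct.
- by rewrite link_sym; [apply: (clean_link_a eN)|apply: live_sym].
apply: (route_front (c := a) (d := q)); distinct.
- by apply: (clean_link_a eN).
apply: (route_back (c := c) (d := x)); distinct.
- by apply: (clean_core eN); distinct.
- by apply: (clean_link eN); distinct.
- by apply: (clean_step eN); distinct.
Qed.

(** Order of visit: the start alone, w, p, a, q, then the other copies with the remainder of b among
    them, and last c. *)
Lemma route_via_shared w p q : 0 < g ->
  (a, p) \in L -> (a, q) \in L -> (b, w) \in L -> (c, w) \in L ->
  p \notin [:: b; c; q] -> q \notin [:: b; c] -> w \notin [:: a; p; q] ->
  hpath r (cov L [set a]) (a, p) (a, q) -> route L (b, w) (c, w).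
Proof.
move=> g0 pL qL bL cL; rewrite !inE !negb_or => /and3P[pb pc pq] /andP[qb qc].
case/and3P => wa wp wq hp; have [pa qa] := (in_arcs_neq pL, in_arcs_neq qL).
have [wb wc] := (in_arcs_neq bL, in_arcs_neq cL); have ab : a != b by rewrite eq_sym.
apply: route_detour bL _ _; first by apply: (clean_link eN); distinct.
rewrite -(cov_out0 (L :\ (b, w))); apply: (route_front (c := w) (d := p)); distinct.
- by apply: (clean_stepD1 eN); distinct.
- by apply: linkD1; [apply: (clean_link eN); distinct|..]; rewrite xpair_eqE negb_and ?wb ?pb.
apply: (route_front (c := p) (d := a)); distinct.
- by apply: (clean_stepD1 eN); distinct.
- apply: linkD1; first by rewrite link_sym; [apply: (clean_link_a eN)|apply: live_sym].
    by rewrite xpair_eqE negb_and pb.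
  by rewrite xpair_eqE negb_and ab.
apply: (route_front (c := a) (d := q)); distinct.
- by rewrite covD1.
- apply: linkD1; first by apply: (clean_link_a eN).
    by rewrite xpair_eqE negb_and ab.
  by rewrite xpair_eqE negb_and qb.
by apply: (clean_coreD1 eN); distinct.
Qed.
End Distinct.

(** A fresh copy for [route_via_fresh] is lacking in both directions only if there are just six
    copies and [i] and [j] both equal the one besides b, p, a, c, q; then [route_via_shared]
    applies. *)
Lemma route_via_pair b c i j p q : b != a -> c != a -> b != c ->
  6 <= t \/ 0 < g -> (a, p) \in L -> (a, q) \in L -> (b, i) \in L -> (c, j) \in L ->
  p \notin [:: b; c; q] -> q \notin [:: b; c] ->
  hpath r (cov L [set a]) (a, p) (a, q) -> route L (b, i) (c, j).
Proof.
move=> ba ca bc tg pL qL iL jL pN qN hp; have [t4 t5] := t_bounds.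
have hq := hpath_sym live_sym hp.
have [pb pc pq] : [/\ p != b, p != c & p != q].
  by move: pN; rewrite !inE !negb_or => /and3P[].
have [qb qc] : q != b /\ q != c by move: qN; rewrite !inE negb_or => /andP[].
have fresh b' c' i' j' x : b' != a -> c' != a -> b' != c' -> (b', i') \in L ->
    (c', j') \in L -> p != b' -> p != c' -> q != b' -> q != c' ->
    x \notin [:: b'; p; a; c'; q; j'] -> route L (b', i') (c', j').
  move=> ba' ca' bc' iL' jL' pb' pc' qb' qc' xN.
  have /and5P[xb xp xa xc /andP[xq xj]] :
      [&& x != b', x != p, x != a, x != c', x != q & x != j'].
    by move: xN; rewrite !inE !negb_or.
  have [pi|pi] := eqVneq p i'; last by apply: (route_via_fresh ba' ca' bc' (x := x) pi) hp; distinct.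
  apply: (route_via_fresh (p := q) (q := p) ba' ca' bc' (x := x)) hq; distinct.
  by rewrite -pi eq_sym.
have [/existsP[x xN]|no_j] := boolP [exists x, x \notin [:: b; p; a; c; q; j]].
  exact: fresh xN.
have [/existsP[x xN]|no_i] := boolP [exists x, x \notin [:: c; p; a; b; q; i]].
  by apply: hpath_sym live_sym _; apply: fresh xN; rewrite // eq_sym.
have g0 : 0 < g.
  case: tg => // t6; have [x xN] : exists x, x \notin [:: b; p; a; c; q; j].
    by apply: pick_out; apply: leq_trans t6 _.
  by case/existsP: no_j; exists x.
have [w wN] : exists x, x \notin [:: b; p; a; c; q].
  by apply: pick_out; apply: leq_trans t5 _.
have wj : w = j.
  apply: contraNeq no_j => wj; apply/existsP; exists w; move: wN.
  by rewrite !inE !negb_or wj andbT.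
have wi : w = i.
  apply: contraNeq no_i => wi; apply/existsP; exists w; move: wN.
  by rewrite !inE !negb_or wi andbT => /and5P[-> -> -> -> ->].
subst i j; move: wN; rewrite !inE !negb_or => /and5P[wb wp wa wc wq].
by apply: (route_via_shared ba ca bc g0 pL qL) hp; distinct.
Qed.

(** The cycle of [a] opens at the vertex facing [c]: after b, x, the other copies and p, the copies
    a and c come last. The end differs from (c, a), where [c] is entered. *)
Lemma route_into_end b c i j p : b != a -> c != a -> b != c -> j != a ->
  (a, p) \in L -> (a, c) \in L -> (b, i) \in L -> (c, j) \in L ->
  p \notin [:: b; c] -> hpath r (cov L [set a]) (a, p) (a, c) ->
  route L (b, i) (c, j).
Proof.
move=> ba ca bc ja pL cL iL jL; rewrite !inE negb_or => /andP[pb pc] hp.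
have pa := in_arcs_neq pL; have [ib jc] := (in_arcs_neq iL, in_arcs_neq jL).
have [t4 t5] := t_bounds; have [x] : exists x, x \notin [:: a; b; c; p; i].
  by apply: pick_out; apply: leq_trans t5 _.
rewrite !inE !negb_or => /and5P[xa xb xc xp xi].
rewrite -(cov_out0 L); apply: (route_front (c := b) (d := x)); distinct.
- by apply: (clean_step eN); distinct.
- by apply: (clean_link eN); distinct.
apply: (route_back (c := c) (d := a)); distinct.
- apply: (route_back (c := a) (d := p)); distinct.
  + by apply: (clean_core eN); distinct.
  + by rewrite link_sym; [apply: (clean_link_a eN)|apply: live_sym].
- by apply: (clean_link_a eN).
- by apply: (clean_step eN); distinct.
Qed.

(** Both ends face [a], so the start enters [a] at once; the remainder of [b] is visited later among
    the other copies. *)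
Lemma route_from_a b c q : b != a -> c != a -> b != c -> 0 < g ->
  (a, b) \in L -> (a, q) \in L -> (b, a) \in L -> (c, a) \in L ->
  q \notin [:: b; c] -> hpath r (cov L [set a]) (a, b) (a, q) ->
  route L (b, a) (c, a).
Proof.
move=> ba ca bc g0 abL qL baL caL; rewrite !inE negb_or => /andP[qb qc] hp.
have qa := in_arcs_neq qL; have ab : a != b by rewrite eq_sym.
apply: route_detour baL _ _.
  by rewrite link_sym; [apply: (clean_link_a eN)|apply: live_sym].
rewrite -(cov_out0 (L :\ (b, a))); apply: (route_front (c := a) (d := q)); distinct.
- by rewrite covD1.
- apply: linkD1; first by apply: (clean_link_a eN).
    by rewrite xpair_eqE negb_and ab.
  by rewrite xpair_eqE negb_and qb.
by apply: (clean_coreD1 eN); distinct.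
Qed.

Lemma route_distinct b c i j : b != a -> c != a -> b != c ->
  (b, i) \in L -> (c, j) \in L -> route L (b, i) (c, j).
Proof.
move=> ba ca bc iL jL; have [t4 t5] := t_bounds.
have cb : c != b by rewrite eq_sym.
(* Opening the cycle of [a] away from both [b] and [c] takes five live vertices; with fewer, only
   one of them can be avoided for sure. *)
have [large|small] := leqP 5 #|cov L [set a]|.
  have [//|p [q [pN qN pq [pL qL] hp]]] := @cycle_a_cut a le_nf_a [:: b; c].
  apply: route_via_pair pL qL iL jL _ qN hp => //.
    case: size_t => [|[]]; [left|right]; move: {+}size_t; last by [].
    by move=> _; have := g; lia.
  by move: pN; rewrite !inE !negb_or => /andP[-> ->].
have g0 : 0 < g.
  case: size_t => [t8|[]//]; have := card_cov_a le_nf_a; lia.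
have good : forall b c i j, b != a -> c != a -> b != c ->
    (b, i) \in L -> (c, j) \in L -> j != a -> route L (b, i) (c, j).
  move=> {iL jL small cb ba ca bc i j b c} b c i j ba ca bc iL jL ja.
  have [|p [q [pN qN pq [pL qL] hp]]] := @cycle_a_cut a le_nf_a [:: b]; first exact: (card_cov_a2 le_nf_a).
  rewrite !inE in pN qN.
  have [qc|qc] := eqVneq q c.
    by subst q; apply: (route_into_end ba ca bc ja pL qL iL jL) hp; distinct.
  have [pc|pc] := eqVneq p c; last first.
    by apply: route_via_pair pL qL iL jL _ _ hp => //; [right|distinct|distinct].
  subst p; apply: (route_into_end ba ca bc ja qL pL iL jL) (hpath_sym live_sym hp).
  by distinct.
have [ja|] := eqVneq j a; last exact: good.
have [ia|ia] := eqVneq i a; last by apply: hpath_sym live_sym _; apply: good.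
subst i j.
have [|p [q [pN qN pq [pL qL] hp]]] := @cycle_a_cut a le_nf_a [:: c]; first exact: (card_cov_a2 le_nf_a).
rewrite !inE in pN qN.
have [qb|qb] := eqVneq q b.
  subst q; apply: (route_from_a ba ca bc g0 qL pL iL jL) (hpath_sym live_sym hp).
  by distinct.
have [pb|pb] := eqVneq p b.
  by subst p; apply: (route_from_a ba ca bc g0 pL qL iL jL) hp; distinct.
by apply: route_via_pair pL qL iL jL _ _ hp => //; [right|distinct|distinct].
Qed.

End Concentrated.

Lemma step_route u v : u \in L -> v \in L -> u != v -> route L u v.
Proof.
case: u v => [b i] [c j] iL jL uv.
have [/existsP[a nf_a]|] := boolP [exists a, g < nf a]; last first.
  rewrite negb_exists => /forallP le_nf.
  have {}le_nf a : nf a <= g by rewrite leqNgt le_nf.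
  have [bc|bc] := eqVneq b c; last exact: route_spread_distinct.
  by subst c; apply: route_spread_same => //; apply: contraNneq uv => ->.
have {}nf_a : nf a = g.+1.
  apply/eqP; rewrite eqn_leq nf_a andbT; apply: leq_trans le_N.
  exact: leq_trans (leq_trans (leq_addr _ _) (leq_addr _ _)) (nfaults_copy FV FE a).
have [ba|ba] := eqVneq b a; have [ca|ca] := eqVneq c a.
- by subst b c; apply: route_both => //; apply: contraNneq uv => ->.
- by subst b; apply: route_one.
- by subst c; apply: hpath_sym live_sym _; apply: route_one.
have [bc|bc] := eqVneq b c; last exact: (route_distinct nf_a).
by subst c; apply: (route_same nf_a) => //; apply: contraNneq uv => ->.
Qed.

End HamiltonianConnected.

(** * Hamiltonian cycles with g+2 faults *)

Section Hamiltonian.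
Hypothesis le_N : N <= g.+2.

Lemma card_alive : 2 < #|L|.
Proof.
have [t4 t5] := t_bounds.
have [a _] : exists x, x \notin ([::] : seq C) by apply: pick_out.
have [b] : exists x, x \notin [:: a] by apply: pick_out; rewrite /= ltnS; apply: (leq_trans _ t5).
rewrite inE eq_sym => ab.
have cC (x : C) : #|copy x| = t by rewrite card_copy card_C.
have cab : #|copy a :|: copy b| = t + t.
  by have := cardsUI (copy a) (copy b); rewrite (copy_disjoint ab) cards0 addn0 !cC.
have sub : (copy a :|: copy b) :\: (FV :&: arcs) \subset L.
  apply/subsetP => p; rewrite !inE => /andP[nF pab].
  have pp : p.1 != p.2 by case/orP: pab => /andP[].
  by rewrite pp !andbT in nF *.
apply: leq_trans (subset_leq_card sub); rewrite cardsD cab.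
have : #|(copy a :|: copy b) :&: (FV :&: arcs)| <= g.+2.
  apply: leq_trans (subset_leq_card (subsetIr _ _)) _.
  exact: leq_trans (leq_addr _ _) le_N.
by move: t4; clear; lia.
Qed.

(** The contracted graph has t+1 vertices and misses at most g+2 edges, hence at most t-2, so it has
    a Hamiltonian cycle to lift. *)
Lemma cycle_spread : (forall a, nf a <= g) -> hcycle r L.
Proof.
move=> le_nf; have [t4 t5] := t_bounds.
have [c _] : exists x, x \notin ([::] : seq C) by apply: pick_out.
have leM : #|pairs_in M [set: C]| <= g.+2.
  apply: leq_trans (leq_trans (card_damaged FV FE) le_N).
  by apply: subset_leq_card; apply/subsetP => e; rewrite inE => /andP[].
have hc : hcycle (free_pair M) [set: C].
  by apply: free_hcycle; rewrite cardsT card_C; move: leM t4 t5; clear; lia.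
have [y [z [yz hp fcy fzc]]] := hcycle_open hc (in_setT c).
have lcy := link_free fcy; have lcz : link r L c z.
  by apply: link_free; rewrite free_pair_sym.
have /and3P[cyL ycL _] := lcy; have /and3P[czL zcL _] := lcz.
apply: (close_cycle card_alive _ lcz lcy).
  by apply: connected_copy; rewrite // eq_sym.
have -> : out [:: c] = [set: C] :\ c by apply/setP => x; rewrite !inE andbT.
have cO : c \notin [set: C] :\ c by rewrite !inE eqxx.
apply: (route_core hp) => //.
- by move=> x x' _ _ _; apply: link_free.
- by move=> x _; apply: connected_copy.
- by move=> e; rewrite e eqxx in yz.
Qed.

(** At most one further fault acts: it makes one vertex of [a] dead or damages one pair elsewhere.
    The cycle of [a] is opened away from it and closed through the other copies. *)
Lemma cycle_concentrated a : nf a = g.+1 -> (forall x, x != a -> nf x <= g) ->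
  hcycle r L.
Proof.
move=> nfa le_nf; have [t4 t5] := t_bounds.
have cnt : nf a + #|dead FV FE a| + #|pairs_in M (out [:: a])| <= N.
  exact: nfaults_copy.
have {}cnt : #|dead FV FE a| + #|pairs_in M (out [:: a])| <= 1.
  by move: cnt le_N; rewrite nfa; clear; lia.
have le_nfa : nf a <= g.+1 by rewrite nfa.
have [|p [q [pd qd pq [pL qL] hp]]] := @cycle_a_cut a le_nfa (enum (dead FV FE a)).
  apply: leq_trans (card_cov_a2 le_nfa); rewrite -cardE; move: cnt; clear; lia.
rewrite !mem_enum in pd qd.
have la x : (a, x) \in L -> x \notin dead FV FE a -> link r L a x.
  rewrite in_arcs => /andP[ax axF] xd; apply: link_free; rewrite /free_pair ax.
  by apply: contra xd => axM; rewrite inE eq_sym ax axF.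
have [lap laq] := (la p pL pd, la q qL qd).
have [pa qa] := (in_arcs_neq pL, in_arcs_neq qL).
apply: (close_cycle card_alive hp lap laq).
have hpath_qp : hpath (free_pair M) (out [:: a]) q p.
  apply: free_hpath; rewrite ?inE // 1?eq_sym // card_out //=.
  rewrite subn1; apply: (leq_trans _ t5); rewrite (leq_add2r 4 _ 1).
  exact: leq_trans (leq_addl _ _) cnt.
have aO : a \notin out [:: a] by rewrite !inE eqxx.
apply: (route_core hpath_qp) => //.
- by move=> x y _ _ _; apply: link_free.
- by move=> x; rewrite !inE => xa; apply: connected_copy; apply: le_nf.
- by move=> e; rewrite e eqxx in pq.
- by case/and3P: laq.
- by case/and3P: lap.
Qed.

Lemma cycle_overloaded a : nf a = g.+2 -> hcycle r L.
Proof.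
move=> nfa; have eN : nf a = N.
  apply/eqP; rewrite eqn_leq nfa le_N andbT -nfa.
  exact: leq_trans (leq_trans (leq_addr _ _) (leq_addr _ _)) (nfaults_copy FV FE a).
have [x [y [xy hp]]] := tolerant_cyclic_cut adj_sym (@copy_cyclic a) nfa.
rewrite -cov_copy in hp.
have [/in_cov_a[p ep pL] /in_cov_a[q eq qL]] := hpath_ends hp; subst x y.
have {xy} pq : p != q by apply: contraNneq xy => ->.
have [pa qa] := (in_arcs_neq pL, in_arcs_neq qL).
apply: (close_cycle card_alive hp); try by apply: (clean_link_a eN).
by apply: (clean_core eN); distinct.
Qed.

(** Twice g+1 being at most g+2 forces g = 0, so t is at least 8. Order of visit: a, q, the other
    copies, p', b, q', p, and back to a. *)
Lemma cycle_two_copies a b : a != b -> nf a = g.+1 -> nf b = g.+1 -> hcycle r L.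
Proof.
move=> ab nfa nfb; have ba : b != a by rewrite eq_sym.
have two : nf a + nf b <= N by apply: nfaults_two.
have g0 : g = 0 by move: two le_N; rewrite nfa nfb; clear; lia.
have eN : nf a + nf b = N.
  by apply/eqP; rewrite eqn_leq two; move: le_N; rewrite nfa nfb g0.
have t8 : 8 <= t by case: size_t => [|[_ + _]]; rewrite g0.
have [le_a le_b] : nf a <= g.+1 /\ nf b <= g.+1 by rewrite nfa nfb.
have large x (le_x : nf x <= g.+1) : 7 <= #|cov L [set x]|.
  by apply: leq_trans (card_cov_a le_x); rewrite g0; move: t8; clear; lia.
have [|p [q [pb qb pq [pL qL] hp]]] := @cycle_a_cut a le_a [:: b].
  exact: leq_trans (large a le_a).
have [|p' [q' [pN qN pq' [pL' qL'] hp']]] := @cycle_a_cut b le_b [:: a; p; q].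
  exact: leq_trans (large b le_b).
rewrite !inE in pb qb.
move: pN qN; rewrite !inE !negb_or => /and3P[pa' pp' pq2] /and3P[qa' qp' qq'].
have [pa qa] := (in_arcs_neq pL, in_arcs_neq qL).
have [pb' qb'] := (in_arcs_neq pL', in_arcs_neq qL').
have con x : x != a -> x != b -> connected r L x.
  move=> xa xb; apply: connected_copy.
  by rewrite /copy_faults (nfaults_two_cover eN ab xa xb).
have lk x y : x != a -> x != b -> y != a -> y != b -> x != y -> link r L x y.
  move=> xa xb ya yb xy; apply: link_free; rewrite /free_pair xy.
  apply/negP => /(damaged_two eN ab xy); rewrite !inE (negbTE xa) (negbTE xb).
  by rewrite (negbTE ya) (negbTE yb) => -[[]|[]].
have lkab x y : x \in [set a; b] -> (x, y) \in L -> y != a -> y != b -> link r L x y.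
  move=> xab xyL ya yb; have := xyL; rewrite in_arcs => /andP[xy xyF].
  apply: link_free; rewrite /free_pair xy; apply/negP => /(damaged_two eN ab xy).
  by rewrite (negbTE xyF) !inE (negbTE ya) (negbTE yb) => -[[]|[]].
have step x i j : x != a -> x != b -> i != x -> j != x -> i != j ->
    hpath r (cov L [set x]) (x, i) (x, j).
  move=> xa xb ix jx ij; have alive k : k != x -> (x, k) \in L.
    move=> kx; rewrite in_arcs eq_sym kx; apply/negP => xkF.
    have [e _] := copy_clean (nfaults_two_cover eN ab xa xb).
    by have := in_set0 (x, k); rewrite -e !inE xkF /= eq_sym kx eqxx.
  by apply: con; rewrite ?alive.
have [lap laq] : link r L a p /\ link r L a q by split; apply: lkab; rewrite ?set21.
have [lbp lbq] : link r L b p' /\ link r L b q' by split; apply: lkab; rewrite ?set22.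
apply: (close_cycle card_alive hp lap laq).
apply: (route_back (c := p) (d := q')); distinct.
- apply: (route_back (c := q') (d := b)); distinct.
  + apply: (route_back (c := b) (d := p')); distinct.
    * have /and3P[_ qaL _] := laq; have /and3P[_ pbL _] := lbp.
      have B1 x : x \in out [:: b; q'; p; a] -> x != a /\ x != b.
        by rewrite !inE !negb_or => /and4P[].
      have qp : q != p' by rewrite eq_sym.
      apply: (route_core (@hpath_neqrel _ (out [:: b; q'; p; a]) q p' _ _ qp)); distinct.
      - by move=> x y /B1[xa xb] /B1[ya yb] _; apply: lk.
      - by move=> x /B1[xa xb]; apply: con.
    * by rewrite link_sym //; apply: live_sym.
  + by apply: step; distinct.
- by apply: lk; distinct.
- by apply: step; distinct.
Qed.

Lemma step_cycle : hcycle r L.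
Proof.
have le_nfN a : nf a <= N.
  exact: leq_trans (leq_trans (leq_addr _ _) (leq_addr _ _)) (nfaults_copy FV FE a).
have [/existsP[a over]|] := boolP [exists a, g.+1 < nf a].
  apply: (@cycle_overloaded a); apply/eqP; rewrite eqn_leq over andbT.
  exact: leq_trans (le_nfN a) le_N.
rewrite negb_exists => /forallP le_nf.
have {}le_nf a : nf a <= g.+1 by rewrite leqNgt le_nf.
have [/existsP[a fa]|] := boolP [exists a, g < nf a]; last first.
  rewrite negb_exists => /forallP le_g; apply: cycle_spread => a.
  by rewrite leqNgt le_g.
have nfa : nf a = g.+1 by apply/eqP; rewrite eqn_leq le_nf.
have [/exists_inP[b ba fb]|] := boolP [exists (b | b != a), g < nf b].
  apply: (@cycle_two_copies a b) => //; first by rewrite eq_sym.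
  by apply/eqP; rewrite eqn_leq le_nf.
rewrite negb_exists_in => /forall_inP le_g; apply: (cycle_concentrated nfa) => x xa.
by rewrite leqNgt le_g.
Qed.

End Hamiltonian.
End Faulty.

Lemma tolerant_connected_step : tolerant_connected arcs adj g.+1.
Proof. by move=> FV FE le_N u v uL vL uv; apply: step_route. Qed.

Lemma tolerant_cyclic_step : tolerant_cyclic arcs adj g.+2.
Proof. by move=> FV FE le_N; apply: step_cycle. Qed.

End Step.

Lemma dcell_adj_sym n k x y : dcell_adj n k x y = dcell_adj n k y x.
Proof.
elim: k x y => [|k IH] x y /=; first by rewrite eq_sym.
by rewrite eq_sym IH; case: eqP => // _; apply: orbC.
Qed.

Lemma dcell_adj_neq n k x y : dcell_adj n k x y -> x != y.
Proof.
elim: k x y => //= k IH x y; case: eqP => [e /IH|ne _].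
  by apply: contraNneq => ->.
by apply: contra_not_neq ne => ->.
Qed.

(** * A checked exhaustive search *)

Section Search.
Variables (n k : nat) (table : seq (seq nat)).
Let T := dcell_t n k.
Hypothesis tableE :
  table = [seq [seq y <- iota 0 T | dcell_adj n k x y] | x <- iota 0 T].

Definition fault := (nat + nat * nat)%type.
Implicit Types (F : seq fault) (p : seq nat).

Definition cuts F x y := (inr (x, y) \in F) || (inr (y, x) \in F).
Definition live_table F := [seq [seq y <- nth [::] table x | ~~ cuts F x y] | x <- iota 0 T].
Definition alive_list F := [seq x <- iota 0 T | inl x \notin F].

(* Depth-first search for a path from [x] to [v] through all [free] vertices.
   A free neighbour of [x] with at most one other free neighbour must come next,
   since otherwise it could only be an end of the path. *)
Fixpoint search (nbrs : seq (seq nat)) (v left : nat) (free : bitseq) (x : nat) :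
    option (seq nat) :=
  if left is left'.+1 then
    let deg y := count (nth false free) (nth [::] nbrs y) in
    let next := [seq y <- nth [::] nbrs x
                | nth false free y & (y != v) || (left' == 0)] in
    let forced := [seq y <- next | (deg y <= 1) && (y != v)] in
    let order := if forced is [::] then
        [seq y <- next | deg y <= 2] ++ [seq y <- next | 2 < deg y]
      else if size forced == 1 then forced else [::] in
    (fix try s := if s is y :: s' then
       if search nbrs v left' (set_nth false free y false) y is Some p
       then Some (y :: p) else try s'
     else None) order
  else if x == v then Some [::] else None.

(** Every answer of [search] is rechecked here, so its pruning carries no proof burden. Covering
    [al] within the length bound makes [u :: p] a rearrangement of [al]. *)
Definition is_route (nbrs : seq (seq nat)) (al : seq nat) u v p :=
  [&& size p < size al, all (mem (u :: p)) al, last u p == v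
    & path (fun x y => y \in nth [::] nbrs x) u p].

Definition find_route nbrs al u v :=
  let free := [seq (x \in al) && (x != u) | x <- iota 0 T] in
  if search nbrs v (size al).-1 free u is Some p then is_route nbrs al u v p
  else false.

Definition connected_under F :=
  let nbrs := live_table F in let al := alive_list F in
  all (fun u => all (find_route nbrs al u) [seq v <- al | v < u]) al.

Definition cyclic_under F :=
  let nbrs := live_table F in let al := alive_list F in
  (2 < size al) &&
  (fix try s := if s is v :: s' then
     if find_route nbrs al (head 0 al) v then true else try s'
   else false) (nth [::] nbrs (head 0 al)).

(** The pair (0, 0) is no edge; as a dummy it pads shorter fault lists to the exact length examined
    by [for_faults]. *)
Definition all_faults : seq fault :=
  inr (0, 0) :: [seq inl x | x <- iota 0 T] ++
  [seq inr (x, y) | x <- iota 0 T, y <- [seq y <- nth [::] table x | x < y]].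

Fixpoint for_faults f (P : seq fault -> bool) F :=
  if f is f'.+1 then all (fun i => for_faults f' P (i :: F)) all_faults else P F.

Lemma for_faultsP f P F : for_faults f P [::] -> size F = f ->
  {subset F <= all_faults} -> P F.
Proof.
move=> + sF subF; rewrite -[F]revK /rev.
have : {subset rev F <= all_faults} by move=> i; rewrite mem_rev; apply: subF.
rewrite -/(rev F); move: sF; rewrite -(size_rev F).
elim: (rev F) f [::] => [|i F' IH] f F0; first by move=> <-.
move=> <- sub /allP H; apply: (IH (size F')) => //.
  by move=> j jF; apply: sub; rewrite inE jF orbT.
by apply: H; apply: sub; apply: mem_head.
Qed.

Let V := 'I_T.
Let adj : rel V := DCell n k.

Lemma mem_table (x : nat) y : x < T -> (y \in nth [::] table x) = (y < T) && dcell_adj n k x y.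
Proof.
move=> xT; rewrite tableE (nth_map 0) ?size_iota // nth_iota // add0n.
by rewrite mem_filter mem_iota /= add0n andbC.
Qed.

Lemma mem_live_table F (x : nat) y : x < T ->
  (y \in nth [::] (live_table F) x) = [&& y < T, dcell_adj n k x y & ~~ cuts F x y].
Proof.
move=> xT; rewrite (nth_map 0) ?size_iota // nth_iota // add0n mem_filter.
by rewrite mem_table // andbC -andbA.
Qed.

Lemma faults_list (FV : {set V}) (FE : {set {set V}}) f :
  nfaults [set: V] FV FE <= f ->
  exists F, [/\ size F = f, {subset F <= all_faults},
    forall x : V, (inl (val x) \in F) = (x \in FV) &
    forall x y : V, adj x y -> [set x; y] \in FE -> cuts F x y].
Proof.
move=> nf.
pose endp (e : {set V}) := [pick p : V * V | [&& p.1 < p.2, adj p.1 p.2 & e == [set p.1; p.2]]].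
pose code e : fault := if endp e is Some p then inr (val p.1, val p.2) else inr (0, 0).
pose F := [seq inl (val x) | x <- enum FV] ++ [seq code e | e <- enum (pairs_in FE setT)].
have sF : size F <= f.
  by rewrite size_cat !size_map -!cardE; move: nf; rewrite /nfaults setIT.
exists (F ++ nseq (f - size F) (inr (0, 0))); split.
- by rewrite size_cat size_nseq subnKC.
- move=> i; rewrite !mem_cat mem_nseq => /orP[/orP[|]|/andP[_ /eqP->]].
  + case/mapP => x _ ->; rewrite inE mem_cat map_f ?orbT //.
    by rewrite mem_iota /=.
  + case/mapP => e _ ->; rewrite /code /endp; case: pickP => [p|_]; last exact: mem_head.
    case/and3P => lt ap _; rewrite inE mem_cat; apply/orP; right; apply/orP; right.
    apply/allpairsPdep; exists (val p.1), (val p.2); split=> //; first by rewrite mem_iota /=.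
    by rewrite mem_filter lt mem_table // ltn_ord.
  + exact: mem_head.
- move=> x; rewrite !mem_cat mem_nseq andbF orbF.
  apply/orP/idP => [[/mapP[y + [/val_inj->]]|/mapP[e _]]|xF].
  + by rewrite mem_enum.
  + by rewrite /code; case: (endp e).
  + by left; apply: map_f; rewrite mem_enum.
- move=> x y xy xyF; have nxy : x != y by have := dcell_adj_neq xy.
  have : code [set x; y] \in F.
    rewrite mem_cat map_f ?orbT // mem_enum inE xyF cards2 nxy.
    by apply/subsetP => z; rewrite inE.
  rewrite /code /endp; case: pickP => [[a b] /= /and3P[ab _ /eqP e] cF|none].
    have eab : (a, b) = (x, y) \/ (a, b) = (y, x).
      have [ax|ax] : a = x \/ a = y by apply/set2P; rewrite e set21.
        by left; rewrite ax (@set2_inj _ x y b) // 1?eq_sym // e ax.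
      by right; rewrite ax (@set2_inj _ y x b) // setUC e ax.
    by rewrite /cuts ![_ \in F ++ _]mem_cat; case: eab => -[<- <-]; rewrite cF ?orbT.
  have [xy'|yx|/val_inj e] := ltngtP x y; last by rewrite e eqxx in nxy.
    by have := none (x, y); rewrite /= xy' xy eqxx.
  have yx' : adj y x by rewrite /adj /DCell dcell_adj_sym.
  by have := none (y, x); rewrite /= yx yx' setUC eqxx.
Qed.

Lemma is_routeP F (FV : {set V}) (FE : {set {set V}}) (u v : V) p :
  (forall x : V, (inl (val x) \in F) = (x \in FV)) ->
  (forall x y : V, adj x y -> [set x; y] \in FE -> cuts F x y) ->
  u \notin FV -> is_route (live_table F) (alive_list F) u v p ->
  hpath (live_edge adj FE) (setT :\: FV) u v.
Proof.
move=> FVE FEE uF /and4P[sz /allP all_in /eqP lv pth].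
have uA : uniq (alive_list F) by rewrite filter_uniq ?iota_uniq.
have [_ eqA] := uniq_min_size uA all_in sz.
have uP := leq_size_uniq uA all_in sz.
have ltT x : x \in val u :: p -> x < T.
  by rewrite -eqA mem_filter mem_iota => /and3P[].
pose q := [seq insubd u x | x <- p].
have vq : map val q = p.
  rewrite -map_comp -[RHS]map_id; apply/eq_in_map => x xp /=.
  by rewrite val_insubd ltT ?inE ?xp ?orbT.
exists q; split.
- by rewrite -(map_inj_uniq val_inj) /= vq.
- move=> x; rewrite -(mem_map val_inj) /= vq -eqA mem_filter mem_iota FVE.
  by rewrite !inE ltn_ord !andbT.
- by apply: val_inj; rewrite -last_map vq.
move: pth; rewrite -vq path_map; apply: sub_path => x y /=.
rewrite mem_live_table // => /and3P[_ xy nc]; rewrite /live_edge [adj _ _]xy.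
by apply: contra nc; apply: FEE.
Qed.

Lemma find_routeP F (FV : {set V}) (FE : {set {set V}}) (u v : V) :
  (forall x : V, (inl (val x) \in F) = (x \in FV)) ->
  (forall x y : V, adj x y -> [set x; y] \in FE -> cuts F x y) ->
  u \notin FV -> find_route (live_table F) (alive_list F) u v ->
  hpath (live_edge adj FE) (setT :\: FV) u v.
Proof.
move=> FVE FEE uF; rewrite /find_route.
by case: search => // p; apply: is_routeP FVE FEE uF.
Qed.

Lemma mem_alive F (FV : {set V}) (x : V) :
  (forall x : V, (inl (val x) \in F) = (x \in FV)) -> (val x \in alive_list F) = (x \notin FV).
Proof. by move=> FVE; rewrite mem_filter mem_iota FVE /= add0n ltn_ord andbT. Qed.

Lemma connected_by_search f : for_faults f connected_under [::] ->
  tolerant_connected setT adj f.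
Proof.
move=> chk FV FE nf u v; rewrite !inE !andbT => uF vF uv.
have [F [sF subF FVE FEE]] := faults_list nf.
have /allP conn := for_faultsP chk sF subF.
have route (x y : V) : x \notin FV -> y \notin FV -> y < x ->
    hpath (live_edge adj FE) (setT :\: FV) x y.
  move=> xF yF lt; apply: (find_routeP FVE FEE xF).
  have /allP/(_ (val y)) := conn (val x) (etrans (mem_alive x FVE) xF).
  by apply; rewrite mem_filter lt (mem_alive y FVE).
have [lt|lt|/val_inj e] := ltngtP u v; last by rewrite e eqxx in uv.
  apply: hpath_sym; first by apply: live_edge_sym => x y; apply: dcell_adj_sym.
  exact: route.
exact: route.
Qed.

Lemma cyclic_by_search f : for_faults f cyclic_under [::] -> tolerant_cyclic setT adj f.
Proof.
move=> chk FV FE nf; have [F [sF subF FVE FEE]] := faults_list nf.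
have /andP[sz found] := for_faultsP chk sF subF.
set u := head 0 (alive_list F) in found.
have [v + fr] : exists2 v, v \in nth [::] (live_table F) u
    & find_route (live_table F) (alive_list F) u v.
  elim: (nth _ _ _) found => //= v s IH; case: ifP => [fr _|_ /IH[w ws fr]].
    by exists v; rewrite ?mem_head.
  by exists w; rewrite // inE ws orbT.
have uA : u \in alive_list F by rewrite /u; case: (alive_list F) sz => // x s _; apply: mem_head.
have uT : u < T by move: uA; rewrite mem_filter mem_iota => /and3P[].
rewrite mem_live_table // => /and3P[vT uv nc].
pose u' : V := Ordinal uT; pose v' : V := Ordinal vT.
have uF : u' \notin FV by rewrite -(mem_alive u' FVE).
have hp : hpath (live_edge adj FE) (setT :\: FV) u' v' by apply: (find_routeP FVE FEE uF).
apply: (hcycle_close hp).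
  rewrite /live_edge [adj _ _]dcell_adj_sym uv /= setUC; apply: contra nc.
  exact: (FEE u' v').
have uAl : uniq (alive_list F) by rewrite filter_uniq ?iota_uniq.
rewrite cardE -(size_map val) (perm_size (_ : perm_eq _ (alive_list F))) //.
apply: uniq_perm => //; first by rewrite map_inj_uniq ?enum_uniq //; apply: val_inj.
move=> x; apply/mapP/idP => [[y + ->]|xA].
  by rewrite mem_enum !inE andbT (mem_alive y FVE).
have xT : x < T by move: xA; rewrite mem_filter mem_iota => /and3P[].
by exists (Ordinal xT); rewrite // mem_enum !inE andbT -(mem_alive _ FVE).
Qed.

End Search.

(** * The four small graphs, by computation *)

Definition dcell_table n k := let T := dcell_t n k in
  [seq [seq y <- iota 0 T | dcell_adj n k x y] | x <- iota 0 T].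
Definition table_2_1 := Eval vm_compute in dcell_table 2 1.
Definition table_3_1 := Eval vm_compute in dcell_table 3 1.
Definition table_4_1 := Eval vm_compute in dcell_table 4 1.
Definition table_2_2 := Eval vm_compute in dcell_table 2 2.

Lemma cyclic_2_1 : tolerant_cyclic setT (DCell 2 1) 0.
Proof. by apply: (@cyclic_by_search _ _ table_2_1); [vm_compute|vm_cast_no_check (erefl true)]. Qed.

Lemma connected_3_1 : tolerant_connected setT (DCell 3 1) 0.
Proof. by apply: (@connected_by_search _ _ table_3_1); [vm_compute|vm_cast_no_check (erefl true)]. Qed.

Lemma cyclic_3_1 : tolerant_cyclic setT (DCell 3 1) 1.
Proof. by apply: (@cyclic_by_search _ _ table_3_1); [vm_compute|vm_cast_no_check (erefl true)]. Qed.

Lemma connected_4_1 : tolerant_connected setT (DCell 4 1) 1.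
Proof. by apply: (@connected_by_search _ _ table_4_1); [vm_compute|vm_cast_no_check (erefl true)]. Qed.

Lemma cyclic_4_1 : tolerant_cyclic setT (DCell 4 1) 2.
Proof. by apply: (@cyclic_by_search _ _ table_4_1); [vm_compute|vm_cast_no_check (erefl true)]. Qed.

Lemma connected_2_2 : tolerant_connected setT (DCell 2 2) 0.
Proof. by apply: (@connected_by_search _ _ table_2_2); [vm_compute|vm_cast_no_check (erefl true)]. Qed.

Lemma cyclic_2_2 : tolerant_cyclic setT (DCell 2 2) 1.
Proof. by apply: (@cyclic_by_search _ _ table_2_2); [vm_compute|vm_cast_no_check (erefl true)]. Qed.

Lemma DCell_sym n k : symmetric (DCell n k).
Proof. by move=> x y; apply: dcell_adj_sym. Qed.

(** * Identifying the recursive construction with arcs *)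

Section Recursion.
Variables n k : nat.
Let t := dcell_t n k.
Let C := 'I_t.+1.
Hypothesis t_gt0 : 0 < t.

Definition copy_adj (a : C) : rel C := fun i j =>
  if unlift a i is Some x then if unlift a j is Some y then DCell n k x y else false
  else false.

(** In copy [a] the vertex with uid x is joined to copy x if x < a and to copy x+1 otherwise, which
    is what [lift a] computes. *)
Definition to_arc (a : C) (x : 'I_t) : C * C := (a, lift a x).

Lemma copy_to_arc a : copy a = to_arc a @: [set: 'I_t].
Proof.
apply/setP => -[b c]; rewrite !inE /=; apply/andP/imsetP => [[bc /eqP ba]|[x _ [-> ->]]].
  subst b; have [x ex _] := unlift_some bc.
  by exists x; [apply: in_setT|rewrite /to_arc ex].
by rewrite eqxx neq_lift.
Qed.

Lemma to_arc_inj a : injective (to_arc a).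
Proof. by move=> x y /(congr1 snd)/lift_inj. Qed.

Lemma to_arc_adj a x y : DCell n k x y -> arc_adj copy_adj (to_arc a x) (to_arc a y).
Proof. by rewrite /arc_adj /= eqxx /copy_adj !liftK. Qed.

Lemma copy_adj_sym a : symmetric (copy_adj a).
Proof.
move=> i j; rewrite /copy_adj; case: (unlift a i) => [x|]; case: (unlift a j) => [y|] //.
exact: DCell_sym.
Qed.

Lemma arc_adj_sym : symmetric (arc_adj copy_adj).
Proof.
move=> p q; rewrite /arc_adj eq_sym andbC; case: eqP => [->|//].
exact: copy_adj_sym.
Qed.

Lemma copy_connected_of f : tolerant_connected [set: 'I_t] (DCell n k) f ->
  forall a, tolerant_connected (copy a) (arc_adj copy_adj) f.
Proof.
move=> tc a; rewrite copy_to_arc; apply: tolerant_connected_transport tc.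
  by move=> x y _ _; apply: to_arc_inj.
by move=> x y _ _; apply: to_arc_adj.
Qed.

Lemma copy_cyclic_of f : tolerant_cyclic [set: 'I_t] (DCell n k) f ->
  forall a, tolerant_cyclic (copy a) (arc_adj copy_adj) f.
Proof.
move=> tc a; rewrite copy_to_arc; apply: tolerant_cyclic_transport tc.
  by move=> x y _ _; apply: to_arc_inj.
by move=> x y _ _; apply: to_arc_adj.
Qed.

Definition arc_code (p : C * C) : nat := p.1 * t + unbump p.1 p.2.

Lemma unbump_lt (p : C * C) : p \in arcs -> unbump p.1 p.2 < t.
Proof. by case: p => a b; rewrite inE => /unlift_some[x /= -> _]; rewrite bumpK. Qed.

Lemma arc_code_div p : p \in arcs -> arc_code p %/ t = p.1 /\ arc_code p %% t = unbump p.1 p.2.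
Proof.
move=> /unbump_lt lt; rewrite /arc_code divnMDl // modnMDl.
by rewrite divn_small // modn_small ?addn0.
Qed.

Lemma arc_code_lt p : p \in arcs -> arc_code p < dcell_t n k.+1.
Proof.
move=> /unbump_lt lt; rewrite /arc_code /= -/t mulnC mulnS.
have le : t * p.1 <= t * t by rewrite leq_mul2l -ltnS ltn_ord orbT.
by rewrite addnC -addSn; apply: leq_add.
Qed.

Lemma dcell_gt0 : 0 < dcell_t n k.+1.
Proof. by rewrite /= muln_gt0 t_gt0. Qed.

Definition of_arc (p : C * C) : 'I_(dcell_t n k.+1) :=
  insubd (Ordinal dcell_gt0) (arc_code p).

Lemma val_of_arc p : p \in arcs -> val (of_arc p) = arc_code p.
Proof. by move=> /arc_code_lt lt; rewrite val_insubd lt. Qed.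

Lemma of_arc_inj : {in arcs &, injective of_arc}.
Proof.
move=> p q pA qA /(congr1 val); rewrite !val_of_arc // => e.
have [dp mp] := arc_code_div pA; have [dq mq] := arc_code_div qA.
have e1 : p.1 = q.1 by apply: val_inj; rewrite /= -dp e dq.
have e2 : unbump p.1 p.2 = unbump q.1 q.2 by rewrite -mp e mq.
have b2 (x : C * C) : x \in arcs -> bump x.1 (unbump x.1 x.2) = x.2 :> nat.
  by rewrite inE => xA; apply: unbumpK; rewrite inE eq_sym.
have {}e2 : p.2 = q.2 by apply: val_inj; rewrite /= -(b2 p pA) e2 e1 b2.
by rewrite [p]surjective_pairing e1 e2 -surjective_pairing.
Qed.

Lemma of_arc_adj : {in arcs &, forall p q, arc_adj copy_adj p q ->
  DCell n k.+1 (of_arc p) (of_arc q)}.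
Proof.
move=> p q pA qA; rewrite /DCell !val_of_arc //= -/t.
have [-> ->] := arc_code_div pA; have [-> ->] := arc_code_div qA.
rewrite /arc_adj -(inj_eq val_inj p.1 q.1) /=; case: eqP => [e|ne].
  rewrite /copy_adj; case: unliftP => // x ex; case: unliftP => // y ey.
  have -> : unbump p.1 p.2 = x by rewrite ex /= bumpK.
  by have -> : unbump q.1 q.2 = y by rewrite ey -e /= bumpK.
case/andP => /eqP ep /eqP eq; rewrite ep eq /unbump.
(* Only the larger label is shifted down by [unbump], giving the uids b-1 in copy a and a in copy b
   for a < b. *)
have [lt|lt|//] := ltngtP p.1 q.1.
- by rewrite subn1 subn0 !eqxx.
- by rewrite subn1 subn0 !eqxx.
Qed.

Lemma of_arc_onto : of_arc @: arcs = [set: 'I_(dcell_t n k.+1)].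
Proof.
apply/setP => y; rewrite inE; apply/imsetP.
have lt1 : y %/ t < t.+1 by rewrite ltn_divLR // mulnC; apply: ltn_ord y.
have lt2 : y %% t < t by rewrite ltn_mod.
pose a : C := Ordinal lt1; have aA : (a, lift a (Ordinal lt2)) \in arcs.
  by rewrite inE neq_lift.
exists (a, lift a (Ordinal lt2)) => //; apply: val_inj.
by rewrite val_of_arc // /arc_code /= bumpK -divn_eq.
Qed.

Lemma dcell_step g : tolerant_connected [set: 'I_t] (DCell n k) g ->
  tolerant_cyclic [set: 'I_t] (DCell n k) g.+1 ->
  g.*2 + 8 <= t \/ [/\ t = g + 4, 0 < g & k = 0] ->
  tolerant_connected [set: 'I_(dcell_t n k.+1)] (DCell n k.+1) g.+1 /\
  tolerant_cyclic [set: 'I_(dcell_t n k.+1)] (DCell n k.+1) g.+2.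
Proof.
move=> tc ty sz; have cC : #|{: C}| = t.+1 by rewrite card_ord.
have tcA := copy_connected_of tc; have tyA := copy_cyclic_of ty.
have cA (a : C) : #|copy a| = t by rewrite card_copy cC.
have sz' : g.*2 + 8 <= t \/ [/\ t = g + 4, 0 < g
    & forall a : C, {in copy a &, forall p q, p != q -> arc_adj copy_adj p q}].
  case: sz => [|[tg g0 k0]]; [by left|right; split=> // a p q].
  rewrite copy_to_arc => /imsetP[x _ ->] /imsetP[y _ ->] xy.
  have {}xy : nat_of_ord x != nat_of_ord y.
    by apply: contraNneq xy => /val_inj->.
  by apply: to_arc_adj; rewrite /DCell; move: (nat_of_ord x) (nat_of_ord y) xy => i j; rewrite k0.
have tsA (a : C) : tolerant_split (copy a) (arc_adj copy_adj) g.
  case: sz' => [large|[tg g0 complete]].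
    by apply: tolerant_split_large (tcA a) _; rewrite cA.
  (* The pair (a, a) is no arc and can serve as the extra vertex. *)
  apply: (@tolerant_split_complete _ _ _ _ (a, a) (complete a)) => //.
    by rewrite !inE eqxx.
  by rewrite cA.
rewrite -of_arc_onto; split.
  apply: tolerant_connected_transport of_arc_inj of_arc_adj _ _.
  exact: (tolerant_connected_step cC arc_adj_sym tcA tyA tsA sz').
apply: tolerant_cyclic_transport of_arc_inj of_arc_adj _ _.
exact: (tolerant_cyclic_step cC arc_adj_sym tcA tyA sz').
Qed.

End Recursion.

(** * The induction on k *)

Lemma complete_tolerant n f : f + 4 = n ->
  tolerant_connected [set: 'I_(dcell_t n 0)] (DCell n 0) f.
Proof.
move=> fn FV FE nf u v uS vS uv.
have lv x y : free_pair FE x y -> live_edge (DCell n 0) FE x y by [].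
apply: hpath_mono (fun x y _ _ _ => @lv x y) _; apply: free_hpath => //.
have le : #|pairs_in FE (setT :\: FV)| <= #|pairs_in FE setT|.
  by apply: subset_leq_card; apply: pairs_in_sub; apply: subsetT.
have : #|FV| + #|setT :\: FV| = n by rewrite setTD cardsC card_ord.
by move: fn nf le; rewrite /nfaults setIT; clear; lia.
Qed.

Lemma complete_cyclic n f : f + 3 = n ->
  tolerant_cyclic [set: 'I_(dcell_t n 0)] (DCell n 0) f.
Proof.
move=> fn FV FE nf.
have le : #|pairs_in FE (setT :\: FV)| <= #|pairs_in FE setT|.
  by apply: subset_leq_card; apply: pairs_in_sub; apply: subsetT.
have cT : #|FV| + #|setT :\: FV| = n by rewrite setTD cardsC card_ord.
by apply: free_hcycle; move: fn nf le cT; rewrite /nfaults setIT; clear; lia.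
Qed.

(** For g = n + k - 4 this is the first alternative of the size condition of the step. *)
Lemma dcell_t_ge n k : 2 <= n -> 0 < k -> (n + k).*2 <= dcell_t n k.
Proof.
move=> n2; elim: k => // -[_ _|k IH _]; first by rewrite addn1 -mul2n /= leq_pmul2r.
have {}IH := IH isT; rewrite [dcell_t _ _]/= -/(dcell_t n k.+1).
move: (dcell_t n k.+1) IH => s IH.
by apply: (@leq_trans (s * 2)); [move: IH n2; clear|rewrite leq_mul2l]; lia.
Qed.

(** The equations for [f] replace truncated subtraction, so nothing is claimed when n + k is too
    small. *)
Lemma dcell_tolerant n k : 2 <= n ->
  (forall f, f + 4 = n + k ->
     tolerant_connected [set: 'I_(dcell_t n k)] (DCell n k) f) /\
  (forall f, f + 3 = n + k ->
     tolerant_cyclic [set: 'I_(dcell_t n k)] (DCell n k) f).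
Proof.
move=> n2; elim: k => [|k [IHc IHy]].
  by split=> f; rewrite addn0; [apply: complete_tolerant|apply: complete_cyclic].
have step g : g + 4 = n + k ->
    g.*2 + 8 <= dcell_t n k \/ [/\ dcell_t n k = g + 4, 0 < g & k = 0] ->
    (forall f, f + 4 = n + k.+1 ->
       tolerant_connected [set: 'I_(dcell_t n k.+1)] (DCell n k.+1) f) /\
    (forall f, f + 3 = n + k.+1 ->
       tolerant_cyclic [set: 'I_(dcell_t n k.+1)] (DCell n k.+1) f).
  move=> gn sz; have t0 : 0 < dcell_t n k by case: sz => [|[-> _ _]]; clear; lia.
  have [c y] := dcell_step t0 (IHc g gn) (IHy g.+1 (etrans (addSnnS g 3) gn)) sz.
  split=> f fn.
    by have -> : f = g.+1 by move: fn gn; clear; lia.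
  by have -> : f = g.+2 by move: fn gn; clear; lia.
have [k0|k0] := posnP k; last first.
  have large := dcell_t_ge n2 k0.
  have [nk|nk] := leqP 4 (n + k).
    apply: (step (n + k - 4)); first by rewrite subnK.
    by left; move: large; rewrite -addnn => large; lia.
  (* Here n + k = 3, so the previous level offers no g to start the step from. *)
  have [-> ->] : n = 2 /\ k = 1 by move: nk n2 k0; clear; lia.
  split=> f fe.
    have -> : f = 0 by move: fe; clear; lia.
    exact: connected_2_2.
  have -> : f = 1 by move: fe; clear; lia.
  exact: cyclic_2_2.
move: IHc IHy step; rewrite k0 => IHc IHy step.
have [n5|n5] := leqP 5 n.
  apply: (step (n - 4)); first by rewrite addn0 subnK // ltnW.
  right; split=> //; first by rewrite /= subnK // ltnW.
  by rewrite subn_gt0.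
(* For n = 2 and 3 no g exists yet; for n = 4 it is 0 and the copies have four vertices, too few for
   the step. *)
have [->|[->|->]] : n = 2 \/ n = 3 \/ n = 4 by move: n2 n5; clear; lia.
- split=> f fe; first by move: fe; clear; lia.
  have -> : f = 0 by move: fe; clear; lia.
  exact: cyclic_2_1.
- split=> f fe.
    have -> : f = 0 by move: fe; clear; lia.
    exact: connected_3_1.
  have -> : f = 1 by move: fe; clear; lia.
  exact: cyclic_3_1.
- split=> f fe.
    have -> : f = 1 by move: fe; clear; lia.
    exact: connected_4_1.
  have -> : f = 2 by move: fe; clear; lia.
  exact: cyclic_4_1.
Qed.

Lemma nfaults_setT (V : finType) (FV : {set V}) FE :
  nfaults [set: V] FV FE <= #|FV| + #|FE|.
Proof.
rewrite /nfaults setIT leq_add2l; apply: subset_leq_card.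
by apply/subsetP => e; rewrite inE => /andP[].
Qed.

Theorem theorem3 (n k : nat) :
  2 <= n ->
  fault_hamiltonian_connected (DCell n k) (n%:Z + k%:Z - 4)%R /\
  fault_hamiltonian (DCell n k) (n%:Z + k%:Z - 3)%R.
Proof.
move=> n2; have [tc ty] := dcell_tolerant k n2; split.
  (* The integer bound dominates a natural number, so it is not negative and the subtraction of
     naturals below is exact. *)
  move=> FV FE _ le u v uF vF uv; have le4 : #|FV| + #|FE| + 4 <= n + k.
    by move: le; clear; lia.
  have e4 : n + k - 4 + 4 = n + k by move: le4; clear; lia.
  have nf : nfaults setT FV FE <= n + k - 4.
    by apply: leq_trans (nfaults_setT FV FE) _; move: le4; clear; lia.
  have inS w : w \notin FV -> w \in [set: 'I_(dcell_t n k)] :\: FV by rewrite !inE andbT.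
  have [s [us es ls p]] := tc _ e4 FV FE nf u v (inS u uF) (inS v vF) uv.
  by exists s; split=> // w; rewrite es !inE andbT.
move=> FV FE _ le; have le3 : #|FV| + #|FE| + 3 <= n + k.
  by move: le; clear; lia.
have e3 : n + k - 3 + 3 = n + k by move: le3; clear; lia.
have nf : nfaults setT FV FE <= n + k - 3.
  by apply: leq_trans (nfaults_setT FV FE) _; move: le3; clear; lia.
have [s [us es s3 c]] := ty _ e3 FV FE nf.
by exists s; split=> // w; rewrite es !inE andbT.
Qed.
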